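(* Let $n\geq1$, $\beta>0$, and let $f(\xi)\in\mathbb{Z}_p[\xi_1,\ldots,\xi_n]$ be an elliptic polynomial of degree $d$. Then there is a positive constant $A$ such that for every $x\in\mathbb{Q}_p^n$ and every $t>0$, \[ |Z(x,t)|\leq A\,t\,\big(\|x\|_p+t^{\frac{1}{\beta d}}\big)^{-d\beta-n}. \]
   Context: $\mathbb{Q}_p$ is the field of $p$-adic numbers, $\mathbb{Z}_p$ its ring of integers, $|\cdot|_p$ the $p$-adic absolute value, $\|x\|_p=\max_i|x_i|_p$. $d\xi$ is the Haar measure on $\mathbb{Q}_p^n$ with $\mathbb{Z}_p^n$ of measure $1$. $\Psi$ is the standard additive character of $\mathbb{Q}_p$, $\Psi(a)=\exp(2\pi i\{a\}_p)$ where $\{a\}_p$ is the fractional part of $a$, and $x\cdot\xi=\sum_i x_i\xi_i$. A polynomial $f\in\mathbb{Q}_p[\xi_1,\dots,\xi_n]$ is elliptic of degree $d$ if it is a non-constant homogeneous polynomial of degree $d$ and $f(\xi)=0\iff\xi=0$. $Z(x,t)=\int_{\mathbb{Q}_p^n}\Psi(x\cdot\xi)e^{-t|f(\xi)|_p^{\beta}}\,d\xi$ for $x\in\mathbb{Q}_p^n$, $t>0$. *)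

(* Defs.v *)
From HB Require Import structures.
From mathcomp Require Import all_boot all_order all_algebra.
From mathcomp Require Import all_classical all_reals all_analysis.
Set Implicit Arguments. Unset Strict Implicit. Unset Printing Implicit Defensive.
Import Order.TTheory GRing.Theory Num.Theory numFieldNormedType.Exports.
Local Open Scope ring_scope.

Definition padic_abs (p : nat) (q : rat) : rat :=
  if q == 0 then 0
  else (p ^ logn p `|denq q|)%:R / (p ^ logn p `|numq q|)%:R.

(* {q}_p : writing q = a / (p^k m) with p not dividing m, {q}_p = r / p^k
   where 0 <= r < p^k and r = a * m^(-1) mod p^k (inverse via Euler:
   m^(-1) = m^(phi(p^k) - 1) mod p^k). Then {q}_p in [0,1), q - {q}_p in Z_p. *)
Definition fracp (p : nat) (q : rat) : rat :=
  let k := logn p `|denq q| in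
  let m := (`|denq q| %/ p ^ k)%N in
  ((modz (numq q * (m ^ (totient (p ^ k)).-1)%:Z) (p ^ k)%:Z)%:~R)
    / (p ^ k)%:R.

(* Q_p as the completion of Q for |.|_p: an element of Q_p is represented   *)
(* by a |.|_p-Cauchy sequence of rationals (all quantities below are limits *)
(* and hence depend only on the p-adic number represented).                 *)

Definition Qp := nat -> rat.

Definition is_Qp (p : nat) (u : Qp) : Prop :=
  forall eps : rat, 0 < eps -> exists N : nat,
    forall m k : nat, (N <= m)%N -> (N <= k)%N -> padic_abs p (u m - u k) < eps.

Definition Qp_cst (q : rat) : Qp := fun _ => q.

Definition Qp_abs (R : realType) (p : nat) (y : Qp) : R :=
  limn (fun k => ratr (padic_abs p (y k)) : R).

Definition Qp_norm (R : realType) (p n : nat) (x : 'I_n -> Qp) : R :=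
  \big[Num.max/0]_(i < n) Qp_abs R p (x i).

Definition Qp_dot (n : nat) (x xi : 'I_n -> Qp) : Qp :=
  fun k => \sum_(i < n) x i k * xi i k.

Definition Psi_re (R : realType) (p : nat) (y : Qp) : R :=
  limn (fun k => cos (2 * pi * ratr (fracp p (y k))) : R).
Definition Psi_im (R : realType) (p : nat) (y : Qp) : R :=
  limn (fun k => sin (2 * pi * ratr (fracp p (y k))) : R).

(* Exponent vectors alpha : 'I_n -> 'I_(d+1); only those with |alpha| = d   *)
(* are used.                                                                *)

Definition mon (n d : nat) := {ffun 'I_n -> 'I_d.+1}.

Definition mdeg (n d : nat) (a : mon n d) : nat := (\sum_(i < n) (a i : nat))%N.

Definition hpoly_eval (n d : nat) (c : mon n d -> Qp) (xi : 'I_n -> Qp) : Qp :=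
  fun k => \sum_(a : mon n d | mdeg a == d) c a k * \prod_(i < n) xi i k ^+ a i.

Definition coeffs_in_Zp (R : realType) (p n d : nat) (c : mon n d -> Qp) : Prop :=
  (forall a, is_Qp p (c a)) /\ (forall a, Qp_abs R p (c a) <= 1).

Definition elliptic (R : realType) (p n d : nat) (c : mon n d -> Qp) : Prop :=
  [/\ (0 < d)%N,
      (exists a : mon n d, mdeg a = d /\ Qp_abs R p (c a) != 0) &
      (forall xi : 'I_n -> Qp, (forall i, is_Qp p (xi i)) ->
         (Qp_abs R p (hpoly_eval c xi) = 0 <-> forall i, Qp_abs R p (xi i) = 0))].

(* Haar integral on Q_p^n (Z_p^n of measure 1), for functions that are      *)
(* continuous and absolutely integrable: Riemann sums over the ball         *)
(* p^(-M) Z_p^n, cut into the p^(Kn) cosets p^(-M) (j + p^K Z_p^n),         *)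
(* j in {0..p^K-1}^n, each of measure p^((M-K)n); limit K -> oo, then the   *)
(* ball exhausts Q_p^n as M -> oo.                                          *)

Definition haar_int (R : realType) (p n : nat) (g : ('I_n -> Qp) -> R) : R :=
  limn (fun M : nat =>
    limn (fun K : nat =>
      ((p ^ (M * n))%:R / (p ^ (K * n))%:R) *
      \sum_(j : {ffun 'I_n -> 'I_(p ^ K)})
         g (fun i => Qp_cst ((j i : nat)%:R / (p ^ M)%:R)))).

Definition Z_re (R : realType) (p n d : nat) (beta : R) (c : mon n d -> Qp)
    (x : 'I_n -> Qp) (t : R) : R :=
  haar_int p (fun xi => Psi_re R p (Qp_dot x xi) *
                         expR (- t * powR (Qp_abs R p (hpoly_eval c xi)) beta)).
Definition Z_im (R : realType) (p n d : nat) (beta : R) (c : mon n d -> Qp)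
    (x : 'I_n -> Qp) (t : R) : R :=
  haar_int p (fun xi => Psi_im R p (Qp_dot x xi) *
                         expR (- t * powR (Qp_abs R p (hpoly_eval c xi)) beta)).

Definition Z_abs (R : realType) (p n d : nat) (beta : R) (c : mon n d -> Qp)
    (x : 'I_n -> Qp) (t : R) : R :=
  Num.sqrt (Z_re p beta c x t ^+ 2 + Z_im p beta c x t ^+ 2).

(* Main.v *)
(* Write u = t^(1/(beta d)).  Ellipticity and compactness of the unit sphere
   give |f(xi)|_p >= p^(-N) ||xi||^d, hence |f(xi + h)|_p = |f(xi)|_p as soon
   as ||h|| <= p^(-N-1) ||xi||.
   If ||x|| <= u, the trivial bound |Z(x,t)| <= int exp(-t |f|^beta), summed
   over spherical layers, is O(u^(-n)).
   If ||x|| > u, replace the weight exp(-t |f|^beta) by 1 on the ball of radius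
   p^(N+1)/||x||.  The new weight is invariant under a translation h with
   |x.h|_p = p, which multiplies Psi(x.xi) by a constant <> 1, so its integral
   against Psi(x.xi) vanishes; the change of weight is at most t |f|^beta,
   which contributes O(t ||x||^(-d beta - n)).
   Both arguments apply verbatim to the finite Riemann sums. *)
Require Import Defs.
From HB Require Import structures.
From mathcomp Require Import all_boot all_order all_algebra.
From mathcomp Require Import all_classical all_reals all_analysis.
From mathcomp Require Import cyclic ring lra zify.
Import Order.TTheory GRing.Theory Num.Theory numFieldNormedType.Exports.
Local Open Scope ring_scope.

(** * The p-adic absolute value on rationals *)

(** The integral is an iterated limit of Riemann sums over the points [j / p^M], so it suffices to
    bound these sums independently of [M] and [K]. In each of them everything is rational
    arithmetic. The coefficients and [x] are only Cauchy sequences, but [f] is bounded away from 0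
    on the unit sphere and [Psi] is trivial on [Z_p], so one late term of each sequence already
    gives the exact values of [|f|_p] and [Psi] at every sample point; for [f] that term does not
    even depend on [M]. In terms of the integer vector [j], a ball around 0 is the condition that a
    fixed power of [p] divides all coordinates. The radius [p^(N+1)/||x||] comes from the
    translation: [h] has norm [p/||x||], and the first norm outside the ball is [p^(N+2)/||x||], so
    [||h|| <= p^(-N-1) ||xi||] holds there. The two regimes combine because the larger of [||x||]
    and [u] is at least half of their sum. *)

Lemma padic_abs0 p : padic_abs p 0 = 0.
Proof. by rewrite /padic_abs eqxx. Qed.

Lemma padic_abs_ge0 p q : 0 <= padic_abs p q.
Proof. by rewrite /padic_abs; case: ifP => // _; rewrite divr_ge0 ?ler0n. Qed.

Lemma padic_abs_gt0 p q : prime p -> q != 0 -> 0 < padic_abs p q.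
Proof.
move=> pp q0; rewrite /padic_abs (negbTE q0).
by rewrite divr_gt0 // ltr0n expn_gt0 prime_gt0.
Qed.

Lemma padic_abs_eq0 p q : prime p -> (padic_abs p q == 0) = (q == 0).
Proof.
move=> pp; case: (eqVneq q 0) => [->|q0]; first by rewrite padic_abs0 eqxx.
by rewrite gt_eqF // padic_abs_gt0.
Qed.

Lemma padic_abs_frac p (a b : int) : prime p -> a != 0 -> b != 0 ->
  padic_abs p (a%:~R / b%:~R) = (p ^ logn p `|b|)%:R / (p ^ logn p `|a|)%:R.
Proof.
move=> pp a0 b0; set q := a%:~R / b%:~R.
have bR : (b%:~R : rat) != 0 by rewrite intr_eq0.
have q0 : q != 0 by rewrite mulf_neq0 ?invr_eq0 // intr_eq0.
have eZ : numq q * b = a * denq q.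
  apply: (intr_inj (R:=rat)); rewrite !intrM.
  have -> : (a%:~R : rat) = q * b%:~R by rewrite /q divfK.
  have -> : ((numq q)%:~R : rat) = q * (denq q)%:~R.
    by rewrite -{2}(divq_num_den q) divfK // intr_eq0 denq_neq0.
  by rewrite -!mulrA [b%:~R * _]mulrC.
have eN : (logn p `|numq q| + logn p `|b| = logn p `|a| + logn p `|denq q|)%N.
  rewrite -!lognM ?absz_gt0 ?numq_eq0 ?denq_neq0 //.
  by rewrite -!abszM eZ.
rewrite /padic_abs (negbTE q0).
have pn0 k : ((p ^ k)%:R : rat) != 0 by rewrite pnatr_eq0 -lt0n expn_gt0 prime_gt0.
apply/eqP; rewrite eqr_div //; apply/eqP.
by rewrite -!natrM -!expnD addnC -eN addnC.
Qed.

Lemma padic_absM p (q r : rat) : prime p ->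
  padic_abs p (q * r) = padic_abs p q * padic_abs p r.
Proof.
move=> pp.
case: (eqVneq q 0) => [->|q0]; first by rewrite mul0r padic_abs0 mul0r.
case: (eqVneq r 0) => [->|r0]; first by rewrite mulr0 padic_abs0 mulr0.
rewrite -{1}(divq_num_den q) -{1}(divq_num_den r) mulf_div -!intrM.
rewrite padic_abs_frac ?mulf_neq0 ?numq_eq0 ?denq_neq0 //.
rewrite !abszM !lognM ?absz_gt0 ?numq_eq0 ?denq_neq0 //.
by rewrite /padic_abs (negbTE q0) (negbTE r0) mulf_div -!natrM -!expnD.
Qed.

Lemma padic_absN p q : padic_abs p (- q) = padic_abs p q.
Proof. by rewrite /padic_abs oppr_eq0 numqN denqN abszN. Qed.

Lemma padic_abs_int p (z : int) : prime p -> z != 0 ->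
  padic_abs p z%:~R = 1 / (p ^ logn p `|z|)%:R.
Proof.
move=> pp z0; have := @padic_abs_frac p z 1 pp z0 isT.
by rewrite divr1 logn1 expn0.
Qed.

Lemma padic_abs_int_le p (z : int) m : prime p ->
  (padic_abs p z%:~R <= 1 / (p ^ m)%:R) = (p ^ m %| `|z|)%N.
Proof.
move=> pp; have pg k : (0 < (p ^ k)%:R :> rat) by rewrite ltr0n expn_gt0 prime_gt0.
case: (eqVneq z 0) => [->|z0].
  by rewrite padic_abs0 divr_ge0 ?ltW // absz0 dvdn0.
rewrite padic_abs_int // pfactor_dvdn ?absz_gt0 // !div1r lef_pV2 ?posrE //.
by rewrite ler_nat leq_exp2l // prime_gt1.
Qed.

Lemma padic_abs_int_le1 p (z : int) : prime p -> padic_abs p z%:~R <= 1.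
Proof.
by move=> pp; have := padic_abs_int_le p z 0 pp; rewrite dvd1n divr1 => ->.
Qed.

Lemma padic_abs_pX p m : prime p -> padic_abs p (p ^ m)%:R = 1 / (p ^ m)%:R.
Proof.
move=> pp; have := @padic_abs_int p (Posz (p ^ m)) pp.
by rewrite pmulrn /= pfactorK // => -> //; rewrite eqz_nat -lt0n expn_gt0 prime_gt0.
Qed.

Lemma padic_abs1 p : prime p -> padic_abs p 1 = 1.
Proof. by move=> pp; have := padic_abs_pX p 0 pp; rewrite expn0 divr1. Qed.

Lemma padic_absX p q k : prime p -> padic_abs p (q ^+ k) = padic_abs p q ^+ k.
Proof.
by move=> pp; elim: k => [|k IH]; rewrite ?expr0 ?padic_abs1 // !exprS padic_absM // IH.
Qed.

Lemma padic_abs_divpX p q m : prime p ->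
  padic_abs p (q / (p ^ m)%:R) = padic_abs p q * (p ^ m)%:R.
Proof.
move=> pp; have pg : ((p ^ m)%:R : rat) != 0 by rewrite pnatr_eq0 -lt0n expn_gt0 prime_gt0.
by rewrite -{2}(divfK pg q) (padic_absM _ (q / _)) // padic_abs_pX // -mulrA div1r mulVf ?mulr1.
Qed.

Lemma padic_abs_expE p q : prime p -> q != 0 ->
  exists a b : nat, padic_abs p q = (p ^ a)%:R / (p ^ b)%:R.
Proof. by move=> pp q0; rewrite /padic_abs (negbTE q0); do 2 eexists. Qed.

Lemma padic_absD p q r : prime p ->
  padic_abs p (q + r) <= Num.max (padic_abs p q) (padic_abs p r).
Proof.
move=> pp.
pose D := denq q * denq r; pose a := numq q * denq r; pose b := numq r * denq q.
have D0 : D != 0 by rewrite mulf_neq0 ?denq_neq0.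
have DR : (D%:~R : rat) != 0 by rewrite intr_eq0.
have [dq dr] : ((denq q)%:~R : rat) != 0 /\ ((denq r)%:~R : rat) != 0.
  by rewrite !intr_eq0 !denq_neq0.
have eq_ : q = a%:~R / D%:~R.
  by rewrite /a /D !intrM invfM mulrACA divff // mulr1 divq_num_den.
have er : r = b%:~R / D%:~R.
  by rewrite /b /D !intrM [X in _ / X]mulrC invfM mulrACA divff // mulr1 divq_num_den.
rewrite eq_ er -mulrDl -intrD !padic_absM // -maxr_pMl ?padic_abs_ge0 //.
apply: ler_wpM2r; first exact: padic_abs_ge0.
case: (eqVneq a 0) => [->|a0]; first by rewrite add0r le_max lexx orbT.
case: (eqVneq b 0) => [->|b0]; first by rewrite addr0 le_max lexx.
rewrite le_max !(padic_abs_int p a) ?(padic_abs_int p b) //.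
rewrite !padic_abs_int_le //.
have H : (p ^ minn (logn p `|a|) (logn p `|b|) %| `|(a + b)%R|)%N.
  have -> : (p ^ minn (logn p `|a|) (logn p `|b|) %| `|(a + b)%R|)%N =
     ((p ^ minn (logn p `|a|) (logn p `|b|))%:Z %| a + b)%Z by [].
  apply: rpredD; rewrite dvdzE pfactor_dvdn ?absz_gt0 //.
    exact: geq_minl.
  exact: geq_minr.
by move: H; case: leqP => _ ->; rewrite ?orbT.
Qed.

Lemma padic_absD_le p q r e : prime p ->
  padic_abs p q <= e -> padic_abs p r <= e -> padic_abs p (q + r) <= e.
Proof. by move=> pp h1 h2; apply: le_trans (padic_absD p q r pp) _; rewrite ge_max h1. Qed.

Lemma padic_abs_sum_le p (I : Type) (s : seq I) (P : pred I) (F : I -> rat) e :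
  prime p -> 0 <= e -> (forall i, P i -> padic_abs p (F i) <= e) ->
  padic_abs p (\sum_(i <- s | P i) F i) <= e.
Proof.
move=> pp e0 H; apply: (big_ind (fun z => padic_abs p z <= e)) => //.
by move=> x y; apply: padic_absD_le.
Qed.

(** The isosceles principle. It is the reason why approximations give exact absolute values
    throughout. *)
Lemma padic_abs_eq p q r : prime p ->
  padic_abs p (q - r) < padic_abs p r -> padic_abs p q = padic_abs p r.
Proof.
move=> pp h; apply: le_anti; apply/andP; split.
  by rewrite -[q](subrK r); apply: padic_absD_le => //; apply: ltW.
have := padic_absD p (r - q) q pp; rewrite subrK le_max => /orP[|//].
by rewrite -(padic_absN _ (r - q)) opprB leNgt h.
Qed.

Lemma inv_expn_lt p (e : rat) : prime p -> 0 < e -> exists N, 1 / (p ^ N)%:R < e.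
Proof.
move=> pp e0; exists (Num.truncn (1 / e)).+1.
have := truncnS_gt (1 / e); set N := (Num.truncn _).+1 => hN.
have hp : (0 < (p ^ N)%:R :> rat) by rewrite ltr0n expn_gt0 prime_gt0.
rewrite ltr_pdivrMr // mulrC -ltr_pdivrMr // (lt_le_trans hN) // ler_nat.
by rewrite ltnW // ltn_expl // prime_gt1.
Qed.

(** * Fractional parts and the additive character *)

(** [Z[1/p]] meets [Z_p] in [Z]. Fractional parts lie in [Z[1/p]], so a congruence between them
    modulo [Z_p] becomes one modulo 1. *)
Lemma padic_integral_int p (q : rat) k : prime p ->
  q * (p ^ k)%:R \is a Num.int -> padic_abs p q <= 1 -> q \is a Num.int.
Proof.
move=> pp /intrP[z hz]; have pg : (0 < (p ^ k)%:R :> rat) by rewrite ltr0n expn_gt0 prime_gt0.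
have -> : q = z%:~R / (p ^ k)%:R by rewrite -hz mulfK // gt_eqF.
rewrite padic_abs_divpX // -ler_pdivlMr // padic_abs_int_le // => d.
have /dvdzP[w ->] : ((p ^ k)%:Z %| z)%Z by rewrite dvdzE.
by rewrite intrM -pmulrn mulfK ?gt_eqF // intr_int.
Qed.

Lemma fracp_itv p q : prime p -> 0 <= fracp p q < 1.
Proof.
move=> pp; rewrite /fracp; set k := logn _ _.
have pg : (0 < (p ^ k)%:R :> rat) by rewrite ltr0n expn_gt0 prime_gt0.
have pz : (p ^ k)%:Z != 0 by rewrite eqz_nat -lt0n expn_gt0 prime_gt0.
apply/andP; split; first by rewrite divr_ge0 ?(ltW pg) // ler0z modz_ge0.
rewrite ltr_pdivrMr // mul1r pmulrn ltr_int.
by apply: ltz_pmod; rewrite lt_neqAle eq_sym pz.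
Qed.

Lemma fracp_pX p q : prime p -> exists k, fracp p q * (p ^ k)%:R \is a Num.int.
Proof.
move=> pp; exists (logn p `|denq q|); rewrite /fracp divfK ?intr_int //.
by rewrite pnatr_eq0 -lt0n expn_gt0 prime_gt0.
Qed.

Lemma padic_abs_subr_fracp p q : prime p -> padic_abs p (q - fracp p q) <= 1.
Proof.
move=> pp; rewrite /fracp; set k := logn _ _; set m := (_ %/ _)%N.
set z := numq q * _; set r := modz _ _.
have pN : (0 < p ^ k)%N by rewrite expn_gt0 prime_gt0.
have d0 : (0 < `|denq q|)%N by rewrite absz_gt0 denq_neq0.
have dE : `|denq q|%N = (m * p ^ k)%N by rewrite divnK // pfactor_dvdnn.
have mp : coprime m p.
  rewrite coprime_sym prime_coprime //; apply/negP => /dvdnP[w hw].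
  have : (p ^ k.+1 %| `|denq q|)%N by rewrite dE hw -mulnA -expnS dvdn_mull.
  by rewrite pfactor_dvdn // ltnn.
have m0 : (0 < m)%N by move: d0; rewrite dE muln_gt0 => /andP[].
have mR : (m%:R : rat) != 0 by rewrite pnatr_eq0 -lt0n.
have pR : ((p ^ k)%:R : rat) != 0 by rewrite pnatr_eq0 -lt0n.
have -> : q - r%:~R / (p ^ k)%:R = (numq q - r * m%:Z)%:~R / m%:R / (p ^ k)%:R.
  rewrite -{1}(divq_num_den q).
  have -> : ((denq q)%:~R : rat) = m%:R * (p ^ k)%:R.
    by rewrite -natrM -dE pmulrn gez0_abs // denq_ge0.
  by rewrite intrB intrM -pmulrn; field; apply/andP; split; [exact: pR | exact: mR].
have am : padic_abs p m%:R = 1.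
  have := @padic_abs_int p m%:Z pp; rewrite -pmulrn /= => -> //.
    suff -> : logn p m = 0%N by rewrite expn0 divr1.
    by rewrite lognE pp m0 -[(p %| m)%N]negbK -prime_coprime // coprime_sym mp.
  by rewrite eqz_nat -lt0n.
rewrite padic_abs_divpX //.
have -> : padic_abs p ((numq q - r * m%:Z)%:~R / m%:R) = padic_abs p (numq q - r * m%:Z)%:~R.
  by rewrite -[in RHS](divfK mR (_ %:~R)) (padic_absM p (_ / _)) // am mulr1.
rewrite -ler_pdivlMr ?ltr0n // padic_abs_int_le //.
suff : ((p ^ k)%:Z %| numq q - r * m%:Z)%Z by rewrite dvdzE.
(* The extra factor [m] completes the exponent to the full totient, and Euler's theorem gives
   [r * m = numq q] modulo [p ^ k]. *)
rewrite -eqz_mod_dvd; apply/eqP; rewrite /r modzMml /z -mulrA -PoszM -expnSr.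
rewrite prednK ?totient_gt0 //.
have h := Euler_exp_totient (coprimeXr k mp).
have h' : ((m ^ totient (p ^ k))%:Z = 1 %[mod (p ^ k)%:Z])%Z.
  by rewrite !modz_nat h.
by rewrite -modzMmr h' modzMmr mulr1.
Qed.

Lemma fracpD p q r : prime p ->
  exists w : int, fracp p (q + r) = fracp p q + fracp p r + w%:~R.
Proof.
move=> pp; set x := fracp p (q + r) - (fracp p q + fracp p r).
suff /intrP[w hw] : x \is a Num.int by exists w; rewrite -hw /x; ring.
have [k1 h1] := fracp_pX p (q + r) pp.
have [[k2 h2] [k3 h3]] := (fracp_pX p q pp, fracp_pX p r pp).
apply: (@padic_integral_int p x (k1 + k2 + k3)) => //.
  have -> : x * (p ^ (k1 + k2 + k3))%:R =
     fracp p (q + r) * (p ^ k1)%:R * (p ^ (k2 + k3))%:R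
     - (fracp p q * (p ^ k2)%:R * (p ^ (k1 + k3))%:R
        + fracp p r * (p ^ k3)%:R * (p ^ (k1 + k2))%:R).
    by rewrite /x !expnD !natrM; ring.
  by apply: rpredB; [|apply: rpredD]; apply: rpredM => //; apply: natr_int.
have -> : x = - (q + r - fracp p (q + r)) + ((q - fracp p q) + (r - fracp p r)).
  by rewrite /x; ring.
apply: padic_absD_le; [exact: pp | rewrite padic_absN; exact: padic_abs_subr_fracp |].
by apply: padic_absD_le; [exact: pp | exact: padic_abs_subr_fracp ..].
Qed.

Lemma fracp_eq0 p q : prime p -> (fracp p q == 0) = (padic_abs p q <= 1).
Proof.
move=> pp; apply/eqP/idP => [h|h].
  by have := padic_abs_subr_fracp p q pp; rewrite h subr0.
have [k hk] := fracp_pX p q pp.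
have /intrP[z hz] : fracp p q \is a Num.int.
  apply: (@padic_integral_int p _ k) => //.
  have -> : fracp p q = - (q - fracp p q) + q by ring.
  by apply: padic_absD_le => //; rewrite padic_absN padic_abs_subr_fracp.
have /andP[] := fracp_itv p q pp; rewrite hz ler0z ltrz1.
by case: z {hz} => // -[].
Qed.

(** The character at a rational point. Complex values are kept as pairs of reals, so the character
    law below is the pair of addition formulas. *)
Definition chi_re (R : realType) p q : R := cos (2 * pi * ratr (fracp p q)).
Definition chi_im (R : realType) p q : R := sin (2 * pi * ratr (fracp p q)).

Lemma cos_sin_Dint (R : realType) (x : R) (w : int) :
  cos (x + 2 * pi * w%:~R) = cos x /\ sin (x + 2 * pi * w%:~R) = sin x.
Proof.
have H (y : R) (m : nat) : cos (y + 2 * pi * m%:R) = cos y /\ sin (y + 2 * pi * m%:R) = sin y.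
  elim: m => [|m [IH1 IH2]]; first by rewrite mulr0 addr0.
  have -> : y + 2 * pi * m.+1%:R = y + 2 * pi * m%:R + pi *+ 2.
    by rewrite -(natr1 m) mulr2n; ring.
  by rewrite cosD2pi sinD2pi.
case: (intP w) => [|m|m]; first by rewrite mulr0 addr0.
  by have := H x m.+1; rewrite -pmulrn.
have := H (x + 2 * pi * (- m.+1%:Z)%:~R) m.+1.
by rewrite -addrA -mulrDr mulrNz -pmulrn addNr mulr0 addr0 => -[-> ->].
Qed.

Lemma chiD (R : realType) p q r : prime p ->
  chi_re R p (q + r) = chi_re R p q * chi_re R p r - chi_im R p q * chi_im R p r /\
  chi_im R p (q + r) = chi_im R p q * chi_re R p r + chi_re R p q * chi_im R p r.
Proof.
move=> pp; have [w hw] := fracpD p q r pp; rewrite /chi_re /chi_im hw.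
rewrite !rmorphD /= ratr_int !(mulrDr (2 * pi)).
by have [-> ->] := @cos_sin_Dint R (2 * pi * ratr (fracp p q) + 2 * pi * ratr (fracp p r)) w; rewrite cosD sinD.
Qed.

Lemma chi_Zp (R : realType) p q : prime p -> padic_abs p q <= 1 ->
  chi_re R p q = 1 /\ chi_im R p q = 0.
Proof.
move=> pp; rewrite -fracp_eq0 // => /eqP h.
by rewrite /chi_re /chi_im h rmorph0 mulr0 cos0 sin0.
Qed.

Lemma chi_congr (R : realType) p q r : prime p -> padic_abs p (q - r) <= 1 ->
  chi_re R p q = chi_re R p r /\ chi_im R p q = chi_im R p r.
Proof.
move=> pp h; have [h1 h2] := @chi_Zp R p (q - r) pp h.
have := @chiD R p r (q - r) pp; rewrite addrC subrK h1 h2 => -[-> ->].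
by rewrite !mulr1 !mulr0 subr0 addr0.
Qed.

(** The real part is [1 - 2 * sin a ^+ 2] with [a] equal to [pi] times the fractional part, which
    lies strictly between 0 and [pi]. *)
Lemma chi_re_neq1 (R : realType) p q : prime p -> 1 < padic_abs p q -> chi_re R p q != 1.
Proof.
move=> pp h; have : fracp p q != 0 by rewrite fracp_eq0 // -ltNge.
have /andP[f0 f1] := fracp_itv p q pp; rewrite neq_lt ltNge f0 /= => fg.
set a : R := pi * ratr (fracp p q).
have : 0 < sin a.
  apply: sin_gt0_pi; rewrite mulr_gt0 ?pi_gt0 ?ltr0q //=.
  by rewrite gtr_pMr ?pi_gt0 // -(rmorph1 (ratr : rat -> R)) ltr_rat.
have -> : chi_re R p q = 1 - 2 * sin a ^+ 2.
  rewrite /chi_re.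
  have -> : 2 * pi * ratr (fracp p q) = a *+ 2 :> R by rewrite mulr2n /a; ring.
  by rewrite cos_mulr2n cos2sin2 mulr2n; ring.
move=> sg; apply/eqP => e; have : 0 < sin a ^+ 2 by rewrite exprn_gt0.
by lra.
Qed.

Lemma chi_re_norm (R : realType) p q : `|chi_re R p q| <= 1.
Proof. exact: cos_max. Qed.
Lemma chi_im_norm (R : realType) p q : `|chi_im R p q| <= 1.
Proof. exact: sin_max. Qed.

(** * Character sums over residue vectors *)

Lemma padic_abs_nat_le1 p m : prime p -> padic_abs p m%:R <= 1.
Proof. by move=> pp; exact: (@padic_abs_int_le1 p m%:Z pp). Qed.

Definition translate (n P : nat) (P0 : (0 < P)%N) (i0 : 'I_n) (h : nat)
    (j : {ffun 'I_n -> 'I_P}) : {ffun 'I_n -> 'I_P} :=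
  [ffun i => if i == i0 then Ordinal (ltn_pmod (j i + h) P0) else j i].

Lemma translate_inj n P (P0 : (0 < P)%N) (i0 : 'I_n) h :
  injective (translate n P P0 i0 h).
Proof.
move=> j k /ffunP e; apply/ffunP => i; have := e i; rewrite !ffunE.
case: eqP => // _ /(congr1 val) /= /eqP; rewrite eqn_modDr !modn_small // => /eqP h'.
exact: val_inj.
Qed.

(** Translating coordinate [i0] by [h = p ^ E.-1] permutes the sample points, fixes [G], and
    multiplies the character by its value at [Y i0 * h]. This number has absolute value exactly [p],
    so the factor is not 1. *)
Lemma chi_sum_eq0 (R : realType) (p n K E : nat) (Y : 'I_n -> rat) (i0 : 'I_n)
    (P0 : (0 < p ^ K)%N) (G : {ffun 'I_n -> 'I_(p ^ K)} -> R) :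
  prime p -> (0 < E)%N -> (E <= K)%N -> padic_abs p (Y i0) = (p ^ E)%:R ->
  (forall j, G (translate n (p ^ K) P0 i0 (p ^ E.-1) j) = G j) ->
  \sum_(j : {ffun 'I_n -> 'I_(p ^ K)}) chi_re R p (\sum_i Y i * (j i : nat)%:R) * G j = 0 /\
  \sum_(j : {ffun 'I_n -> 'I_(p ^ K)}) chi_im R p (\sum_i Y i * (j i : nat)%:R) * G j = 0.
Proof.
move=> pp E0 EK aY GT; set h := (p ^ E.-1)%N in GT *.
pose D (j : {ffun 'I_n -> 'I_(p ^ K)}) : rat := \sum_i Y i * (j i : nat)%:R.
set T := translate n (p ^ K) P0 i0 h in GT *.
have pR k : (0 < (p ^ k)%:R :> rat) by rewrite ltr0n expn_gt0 prime_gt0.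
(* Reduction modulo [p ^ K] changes the argument by a multiple of [Y i0 * p ^ K], which lies in
   [Z_p] because [E <= K]. *)
have DT j : padic_abs p (D (T j) - (D j + Y i0 * h%:R)) <= 1.
  rewrite /D (bigD1 i0) //= [in X in _ - (X + _)](bigD1 i0) //=.
  rewrite (eq_bigr (fun i => Y i * (j i : nat)%:R)); last first.
    by move=> i /negbTE ni; rewrite ffunE ni.
  rewrite ffunE eqxx /=.
  have e : ((j i0 + h) %% p ^ K)%:R = (j i0 : nat)%:R + h%:R - ((j i0 + h) %/ p ^ K)%:R * (p ^ K)%:R :> rat.
    by rewrite -natrD -natrM {2}(divn_eq (j i0 + h) (p ^ K)) natrD addrC addKr.
  rewrite e; set u := \sum_(i < n | _) _; set m := (_ %/ _)%N.
  have -> : Y i0 * ((j i0 : nat)%:R + h%:R - m%:R * (p ^ K)%:R) + u - (Y i0 * (j i0 : nat)%:R + u + Y i0 * h%:R) = - (Y i0 * m%:R * (p ^ K)%:R) by ring.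
  rewrite padic_absN !padic_absM // aY padic_abs_pX //.
  rewrite mulrA mulr1 ler_pdivrMr // mul1r.
  apply: (@le_trans _ _ ((p ^ E)%:R * 1)); last by rewrite mulr1 ler_nat leq_exp2l // prime_gt1.
  by rewrite ler_pM2l // padic_abs_nat_le1.
set c0 := chi_re R p (Y i0 * h%:R); set s0 := chi_im R p (Y i0 * h%:R).
have c1 : c0 != 1.
  apply: chi_re_neq1 => //; rewrite padic_absM // aY padic_abs_pX // mulrA mulr1.
  by rewrite ltr_pdivlMr // mul1r ltr_nat ltn_exp2l ?prime_gt1 // prednK.
have cT j : chi_re R p (D (T j)) = chi_re R p (D j) * c0 - chi_im R p (D j) * s0 /\
     chi_im R p (D (T j)) = chi_im R p (D j) * c0 + chi_re R p (D j) * s0.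
  have [-> ->] := @chi_congr R p _ _ pp (DT j).
  exact: chiD.
rewrite -/(D _).
set S := \sum_j chi_re R p (D j) * G j; set S' := \sum_j chi_im R p (D j) * G j.
have eS : S = c0 * S - s0 * S'.
  rewrite {1}/S (reindex_inj (@translate_inj n (p ^ K) P0 i0 h)) /= !mulr_sumr -sumrB.
  by apply: eq_bigr => j _; rewrite -/T GT (cT j).1; ring.
have eS' : S' = c0 * S' + s0 * S.
  rewrite {1}/S' (reindex_inj (@translate_inj n (p ^ K) P0 i0 h)) /= !mulr_sumr -big_split /=.
  by apply: eq_bigr => j _; rewrite -/T GT (cT j).2; ring.
(* The determinant of the linear system [eS], [eS'] in [S] and [S']: the squared modulus of 1 minus
   the factor. *)
have q0 : (1 - c0) ^+ 2 + s0 ^+ 2 != 0.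
  by rewrite gt_eqF // ltr_pwDl ?sqr_ge0 // exprn_even_gt0 //= subr_eq0 eq_sym.
split; apply/eqP.
  have : S * ((1 - c0) ^+ 2 + s0 ^+ 2) == 0.
    have -> : S * ((1 - c0) ^+ 2 + s0 ^+ 2) =
      (1 - c0) * (S - (c0 * S - s0 * S')) - s0 * (S' - (c0 * S' + s0 * S)) by ring.
    by rewrite -eS -eS' !subrr !mulr0 subrr.
  by rewrite mulf_eq0 (negbTE q0) orbF.
have : S' * ((1 - c0) ^+ 2 + s0 ^+ 2) == 0.
  have -> : S' * ((1 - c0) ^+ 2 + s0 ^+ 2) =
    (1 - c0) * (S' - (c0 * S' + s0 * S)) + s0 * (S - (c0 * S - s0 * S')) by ring.
  by rewrite -eS -eS' !subrr !mulr0 addr0.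
by rewrite mulf_eq0 (negbTE q0) orbF.
Qed.

Lemma card_dvd_expn_le (p n K w : nat) : prime p -> (w <= K)%N ->
  (#|[pred j : {ffun 'I_n -> 'I_(p ^ K)} | [forall i, p ^ w %| j i]]| <= p ^ ((K - w) * n))%N.
Proof.
move=> pp wK; have pw k : (0 < p ^ k)%N by rewrite expn_gt0 prime_gt0.
pose B := [pred a : 'I_(p ^ K) | (p ^ w %| a)%N].
have -> : #|[pred j : {ffun 'I_n -> 'I_(p ^ K)} | [forall i, (p ^ w %| j i)%N]]| = #|@ffun_on_mem 'I_n _ (mem B)|.
  apply: eq_card => j; rewrite [LHS]inE /=.
  by apply/forallP/ffun_onP => H i; have := H i; rewrite inE.
rewrite card_ffun_on card_ord expnM.
suff : (#|B| <= p ^ (K - w))%N.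
  by move=> H; case: n => [|n]; rewrite ?expn0 // leq_exp2r.
rewrite -[X in (_ <= X)%N]card_ord.
have lt (a : 'I_(p ^ K)) : (a %/ p ^ w < p ^ (K - w))%N.
  by rewrite ltn_divLR // -expnD subnK.
apply: (leq_card_in (fun a => Ordinal (lt a))) => a b; rewrite !inE => ha hb /(congr1 val) /= e.
by apply: val_inj; rewrite /= -(divnK ha) e divnK.
Qed.

(** * Homogeneous polynomials at integer vectors *)

Definition hpoly_rat (n d : nat) (C : mon n d -> rat) (xi : 'I_n -> rat) : rat :=
  \sum_(a : mon n d | mdeg a == d) C a * \prod_(i < n) xi i ^+ a i.

Lemma hpoly_ratZ n d C (l : rat) xi :
  hpoly_rat n d C (fun i => l * xi i) = l ^+ d * hpoly_rat n d C xi.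
Proof.
rewrite /hpoly_rat mulr_sumr; apply: eq_bigr => a /eqP ad.
rewrite (eq_bigr (fun i => l ^+ a i * xi i ^+ a i)); last by move=> i _; rewrite exprMn.
by rewrite big_split /= -expr_sum -/(mdeg a) ad; ring.
Qed.

Lemma padic_abs_eqmod p m (a b : nat) : prime p ->
  (padic_abs p (a%:R - b%:R) <= 1 / (p ^ m)%:R) = (a == b %[mod p ^ m]).
Proof.
move=> pp; have -> : a%:R - b%:R = (a%:Z - b%:Z)%:~R :> rat by rewrite intrB.
rewrite padic_abs_int_le //.
by rewrite -[LHS]/((p ^ m)%:Z %| a%:Z - b%:Z)%Z -eqz_mod_dvd !modz_nat.
Qed.

Lemma hpoly_rat_abs_le p n d (C : mon n d -> rat) (v : 'I_n -> nat) e :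
  prime p -> 0 <= e -> (forall a, padic_abs p (C a) <= e) ->
  padic_abs p (hpoly_rat n d C (fun i => (v i)%:R)) <= e.
Proof.
move=> pp e0 Ce; apply: padic_abs_sum_le => // a _; rewrite padic_absM //.
rewrite (eq_bigr (fun i => (v i ^ a i)%:R)); last by move=> i _; rewrite natrX.
rewrite -natr_prod -[e]mulr1; apply: ler_pM; rewrite ?padic_abs_ge0 //.
exact: padic_abs_nat_le1.
Qed.

Lemma hpoly_ratB_coef n d (C C' : mon n d -> rat) xi :
  hpoly_rat n d C xi - hpoly_rat n d C' xi = hpoly_rat n d (fun a => C a - C' a) xi.
Proof. by rewrite /hpoly_rat -sumrB; apply: eq_bigr => a _; rewrite mulrBl. Qed.

Lemma hpoly_rat_eqmod p n d (C : mon n d -> rat) (v w : 'I_n -> nat) m :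
  prime p -> (forall a, padic_abs p (C a) <= 1) ->
  (forall i, v i = w i %[mod p ^ m]) ->
  padic_abs p (hpoly_rat n d C (fun i => (v i)%:R) - hpoly_rat n d C (fun i => (w i)%:R))
    <= 1 / (p ^ m)%:R.
Proof.
move=> pp C1 vw; rewrite /hpoly_rat -sumrB.
apply: padic_abs_sum_le => // a _.
rewrite -mulrBr padic_absM // -[leRHS]mul1r; apply: ler_pM; rewrite ?padic_abs_ge0 //.
have E (u : 'I_n -> nat) : \prod_i (u i)%:R ^+ a i = (\prod_i u i ^ a i)%N%:R :> rat.
  by rewrite natr_prod; apply: eq_bigr => i _; rewrite natrX.
rewrite !E padic_abs_eqmod //; apply/eqP.
elim/big_ind2: _ => // [x1 x2 y1 y2 h1 h2|i _]; first by rewrite -modnMm h1 h2 modnMm.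
by rewrite -modnXm vw modnXm.
Qed.

(** Polar decomposition: [p ^ s] is the greatest power of [p] common to all coordinates, and [u] has
    norm 1. Homogeneity then reduces questions about [f] to the unit sphere. *)
Lemma pdvd_factor p n (v : 'I_n -> nat) w :
  ~ (forall i, p ^ w %| v i)%N ->
  exists s (u : 'I_n -> nat), [/\ (s < w)%N, forall i, v i = (p ^ s * u i)%N
    & exists i, ~~ (p %| u i)%N].
Proof.
elim: w v => [|w IH] v H; first by case: H => i; rewrite dvd1n.
case: (boolP [forall i, (p %| v i)%N]) => [/forallP h|/forallPn[i hi]]; last first.
  by exists 0%N, v; split=> //; [move=> j; rewrite expn0 mul1n | exists i].
have [|s [u [sw hu pu]]] := IH (fun i => v i %/ p)%N.
  move=> h'; apply: H => i; rewrite -(divnK (h i)) expnSr.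
  exact: dvdn_mul (h' i) _.
exists s.+1, u; split=> // i.
by rewrite -(divnK (h i)) hu expnSr; lia.
Qed.

(** The nonnegative integer points of the unit sphere. *)
Definition primitive (p n : nat) (v : 'I_n -> nat) := exists i, ~~ (p %| v i)%N.

Lemma hpoly_rat_scale p n d (C : mon n d -> rat) s (v u : 'I_n -> nat) : prime p ->
  (forall i, v i = (p ^ s * u i)%N) ->
  padic_abs p (hpoly_rat n d C (fun i => (v i)%:R)) =
   padic_abs p (hpoly_rat n d C (fun i => (u i)%:R)) / (p ^ (s * d))%:R.
Proof.
move=> pp vu.
have -> : (fun i => (v i)%:R) = (fun i => (p ^ s)%:R * (u i)%:R) :> ('I_n -> rat).
  by apply: funext => i; rewrite vu natrM.
by rewrite hpoly_ratZ -natrX -expnM padic_absM // padic_abs_pX // div1r mulrC.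
Qed.

Lemma hpoly_rat_lower p n d (C : mon n d -> rat) N w (v : 'I_n -> nat) : prime p ->
  (forall v, primitive p n v ->
     1 / (p ^ N)%:R < padic_abs p (hpoly_rat n d C (fun i => (v i)%:R))) ->
  ~ (forall i, p ^ w %| v i)%N ->
  exists s, [/\ (s < w)%N, (forall i, p ^ s %| v i)%N &
    1 / (p ^ (N + s * d))%:R <= padic_abs p (hpoly_rat n d C (fun i => (v i)%:R))].
Proof.
move=> pp H /pdvd_factor[s [u [sw vu pu]]]; exists s; split=> // [i|].
  by rewrite vu dvdn_mulr.
rewrite (hpoly_rat_scale _ _ _ _ _ _ _ pp vu) expnD natrM invfM mulrA ler_wpM2r //.
exact/ltW/H.
Qed.

(** Divided by the common power [p ^ s] of [v], the two vectors still agree modulo [p ^ N], since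
    [s < E - N.+1]. The values then differ by at most [p^(-N)], strictly less than the value at the
    primitive vector [u]. *)
Lemma hpoly_rat_shift p n d (C : mon n d -> rat) N (v v' : 'I_n -> nat) E : prime p ->
  (forall a, padic_abs p (C a) <= 1) ->
  (forall v, primitive p n v ->
     1 / (p ^ N)%:R < padic_abs p (hpoly_rat n d C (fun i => (v i)%:R))) ->
  (N.+1 <= E)%N -> ~ (forall i, p ^ (E - N.+1) %| v i)%N ->
  (forall i, v' i = v i %[mod p ^ E.-1]) ->
  padic_abs p (hpoly_rat n d C (fun i => (v' i)%:R)) =
  padic_abs p (hpoly_rat n d C (fun i => (v i)%:R)).
Proof.
move=> pp C1 H NE /pdvd_factor[s [u [sw vu pu]]] vv.
have p0 k : (0 < p ^ k)%N by rewrite expn_gt0 prime_gt0.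
have d' i : (p ^ s %| v' i)%N.
  have sE : (p ^ s %| p ^ E.-1)%N by apply: dvdn_exp2l; lia.
  rewrite /dvdn -(modn_dvdm _ sE) vv modn_dvdm // vu.
  by rewrite modnMr.
have v'u i : v' i = (p ^ s * (v' i %/ p ^ s))%N by rewrite mulnC divnK.
rewrite (hpoly_rat_scale _ _ _ _ _ _ _ pp vu) (hpoly_rat_scale _ _ _ _ _ _ _ pp v'u); congr (_ / _).
apply: padic_abs_eq => //; apply: le_lt_trans (H u pu).
apply: hpoly_rat_eqmod => // i.
have e : (p ^ E.-1 = p ^ s * p ^ (E.-1 - s))%N by rewrite -expnD subnKC //; lia.
have := vv i; rewrite {1}(v'u i) vu e => /eqP; rewrite -!muln_modr eqn_pmul2l // => /eqP h.
have dN : (p ^ N %| p ^ (E.-1 - s))%N by apply: dvdn_exp2l; move: sw NE; clear; lia.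
by rewrite -(modn_dvdm _ dN) h modn_dvdm.
Qed.

(* The weight is made translation invariant by flattening it to [1] on the
   small ball, at the cost [delta] per point of that ball. *)
Lemma chi_sum_le (R : realType) (p n d K E N : nat) (Y : 'I_n -> rat) (i0 : 'I_n)
    (C : mon n d -> rat) (F : rat -> R) (delta : R) :
  prime p -> (N.+1 <= E)%N -> (E <= K)%N -> padic_abs p (Y i0) = (p ^ E)%:R ->
  (forall a, padic_abs p (C a) <= 1) ->
  (forall v, primitive p n v ->
     1 / (p ^ N)%:R < padic_abs p (hpoly_rat n d C (fun i => (v i)%:R))) ->
  (forall s, s <= 1 / (p ^ ((E - N.+1) * d))%:R -> 0 <= s -> `|F s - 1| <= delta) ->
  let W (j : {ffun 'I_n -> 'I_(p ^ K)}) :=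
    F (padic_abs p (hpoly_rat n d C (fun i => (j i : nat)%:R))) in
  `|\sum_(j : {ffun 'I_n -> 'I_(p ^ K)})
     chi_re R p (\sum_i Y i * (j i : nat)%:R) * W j|
    <= (p ^ ((K - (E - N.+1)) * n))%:R * delta /\
  `|\sum_(j : {ffun 'I_n -> 'I_(p ^ K)})
     chi_im R p (\sum_i Y i * (j i : nat)%:R) * W j|
    <= (p ^ ((K - (E - N.+1)) * n))%:R * delta.
Proof.
move=> pp NE EK aY C1 H HF W; set w := (E - N.+1)%N.
have P0 : (0 < p ^ K)%N by rewrite expn_gt0 prime_gt0.
pose B (j : {ffun 'I_n -> 'I_(p ^ K)}) := [forall i, (p ^ w %| j i)%N].
pose G j := if B j then 1 else W j.
have d0 : 0 <= delta.
  by apply: le_trans (HF 0 _ (lexx _)) => //; rewrite divr_ge0.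
have GT j : G (translate n (p ^ K) P0 i0 (p ^ E.-1) j) = G j.
  set t := translate _ _ _ _ _ _.
  have tj i : (t i : nat) = j i %[mod p ^ E.-1].
    rewrite /t ffunE; case: eqP => // ->; rewrite /= modn_dvdm ?modnDr //.
    by apply: dvdn_exp2l; lia.
  have wE : (p ^ w %| p ^ E.-1)%N by apply: dvdn_exp2l; rewrite /w; lia.
  have BT : B t = B j.
    by apply: eq_forallb => i; rewrite /dvdn -(modn_dvdm _ wE) tj modn_dvdm.
  rewrite /G BT; case: ifP => // /forallP nB; congr F.
  by apply: (@hpoly_rat_shift p n d C N _ _ E).
have key (c : rat -> R) : (forall q, `|c q| <= 1) ->
  \sum_(j : {ffun 'I_n -> 'I_(p ^ K)}) c (\sum_i Y i * (j i : nat)%:R) * G j = 0 ->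
  `|\sum_(j : {ffun 'I_n -> 'I_(p ^ K)}) c (\sum_i Y i * (j i : nat)%:R) * W j|
    <= (p ^ ((K - w) * n))%:R * delta.
  move=> c1 S0.
  rewrite -[X in `|X|](addrK (\sum_(j : {ffun 'I_n -> 'I_(p ^ K)}) c (\sum_i Y i * (j i : nat)%:R) * G j)).
  rewrite [X in _ + X - _]S0 addr0 -sumrB.
  apply: le_trans (ler_norm_sum _ _ _) _.
  apply: (@le_trans _ _ (\sum_(j | B j) delta)).
    rewrite [leRHS]big_mkcond /=; apply: ler_sum => j _; rewrite -mulrBr normrM /G.
    case: ifP => [/forallP Bj|_]; last by rewrite subrr normr0 mulr0.
    rewrite -[leRHS]mul1r; apply: ler_pM => //; apply: HF; last exact: padic_abs_ge0.
    (* On the ball, homogeneity and integral coefficients give a value of at most [p^(-w d)], the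
       range covered by [HF]. *)
    have ju i : (j i : nat) = (p ^ w * (j i %/ p ^ w))%N by rewrite mulnC divnK.
    rewrite (hpoly_rat_scale p n d C _ _ _ pp ju) ler_wpM2r //.
    by apply: hpoly_rat_abs_le.
  rewrite sumr_const -[delta *+ _]mulr_natl ler_wpM2r // ler_nat.
  by apply: card_dvd_expn_le => //; rewrite /w; lia.
have E0 : (0 < E)%N by lia.
have [S1 S2] := @chi_sum_eq0 R p n K E Y i0 P0 G pp E0 EK aY GT.
by split; apply: key => // q; [exact: chi_re_norm | exact: chi_im_norm].
Qed.

(** * Limits and compactness *)

(* No convergence is needed: [limn] of a divergent sequence is [0]. *)
Lemma limn_norm_le (R : realType) (u : nat -> R) (B : R) : 0 <= B ->
  (exists N, forall k, (N <= k)%N -> `|u k| <= B) -> `|limn u| <= B.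
Proof.
move=> B0 [N H]; have [cu|/dvgP ->] := pselect (cvgn u); last by rewrite normr0.
rewrite ler_norml; apply/andP; split.
  by apply: limr_ge => //; exists N => // k /H; rewrite ler_norml => /andP[].
by apply: limr_le => //; exists N => // k /H; rewrite ler_norml => /andP[].
Qed.

Lemma limn_eventually_cst (R : realType) (u : nat -> R) (l : R) :
  (exists N, forall k, (N <= k)%N -> u k = l) -> limn u = l.
Proof.
move=> [N H]; apply: cvg_lim => //; apply: cvg_near_cst.
by exists N => // k /H.
Qed.

Lemma haar_int_norm_le (R : realType) (p n : nat) (g : ('I_n -> Qp) -> R) (B : R) : 0 <= B ->
  (exists M0, forall M, (M0 <= M)%N -> exists K0, forall K, (K0 <= K)%N ->
   `|(p ^ (M * n))%:R / (p ^ (K * n))%:R * \sum_(j : {ffun 'I_n -> 'I_(p ^ K)})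
         g (fun i => Qp_cst ((j i : nat)%:R / (p ^ M)%:R))| <= B) ->
  `|haar_int p g| <= B.
Proof.
move=> B0 [M0 H]; apply: limn_norm_le => //; exists M0 => M /H[K0 HK].
by apply: limn_norm_le => //; exists K0.
Qed.

Lemma limn_ratr_null (R : realType) (u : nat -> rat) : (forall k, 0 <= u k) ->
  (forall e : rat, 0 < e -> exists N, forall k, (N <= k)%N -> u k < e) ->
  limn (fun k => ratr (u k) : R) = 0.
Proof.
move=> u0 H; apply: cvg_lim => //; apply/cvgrPdist_lt => e e0.
pose q : rat := (Num.truncn e^-1).+1%:R^-1.
have q0 : 0 < q by rewrite invr_gt0 ltr0n.
have [N HN] := H q q0; exists N => // k /HN h.
rewrite sub0r normrN ger0_norm ?ler0q //; apply: lt_trans (_ : ratr q < e).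
  by rewrite ltr_rat.
rewrite /q fmorphV rmorph_nat invf_plt ?posrE ?ltr0n //.
exact: truncnS_gt.
Qed.

(** If the sequence does not tend to 0, some [e] is reached at arbitrarily late indices. Beyond the
    Cauchy threshold for [e], the isosceles principle freezes the absolute value. *)
Lemma Qp_abs_spec (R : realType) (p : nat) (u : Qp) : prime p -> is_Qp p u ->
  (Qp_abs R p u = 0 /\
   forall e : rat, 0 < e -> exists N, forall k, (N <= k)%N -> padic_abs p (u k) < e) \/
  exists (q : rat) (N : nat), [/\ q != 0, Qp_abs R p u = ratr (padic_abs p q)
    & forall k, (N <= k)%N -> padic_abs p (u k) = padic_abs p q].
Proof.
move=> pp cu.
have [H|] := pselect (forall e : rat, 0 < e -> exists N, forall k, (N <= k)%N -> padic_abs p (u k) < e).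
  by left; split=> //; apply: limn_ratr_null => // k; exact: padic_abs_ge0.
move=> /existsNP[e /not_implyP[e0 He]]; right.
have [N HN] := cu e e0.
have [k0 [Nk0 hk0]] : exists k0, (N <= k0)%N /\ e <= padic_abs p (u k0).
  apply: contrapT => h; apply: He; exists N => k Nk; rewrite ltNge; apply/negP => h'.
  by apply: h; exists k.
have HE k : (N <= k)%N -> padic_abs p (u k) = padic_abs p (u k0).
  by move=> Nk; apply: padic_abs_eq => //; apply: lt_le_trans hk0; apply: HN.
exists (u k0), N; split=> //.
  by rewrite -(padic_abs_eq0 p) // gt_eqF // (lt_le_trans e0).
by apply: limn_eventually_cst; exists N => k /HE ->.
Qed.

Lemma eventually_finite (T : finType) (P : T -> nat -> Prop) :
  (forall a, exists N, forall k, (N <= k)%N -> P a k) ->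
  exists N, forall k, (N <= k)%N -> forall a, P a k.
Proof.
move=> /choice[N HN]; exists (\max_a N a)%N => k hk a; apply: HN.
exact: leq_trans (leq_bigmax a) hk.
Qed.

Lemma is_Qp_unif (p : nat) (T : finType) (c : T -> Qp) (e : rat) :
  (forall a, is_Qp p (c a)) -> 0 < e ->
  exists N, forall m k, (N <= m)%N -> (N <= k)%N -> forall a, padic_abs p (c a m - c a k) < e.
Proof.
move=> cc e0; have [a|N HN] := @eventually_finite T
  (fun a N => forall m k, (N <= m)%N -> (N <= k)%N -> padic_abs p (c a m - c a k) < e).
  have [N HN] := cc a e e0; exists N => k Nk m l km kl.
  by apply: HN; exact: leq_trans Nk _.
by exists N => m k Nm Nk a; apply: (HN N).
Qed.

Lemma coeffs_eventually_le1 (R : realType) p n d (c : mon n d -> Qp) : prime p ->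
  coeffs_in_Zp R p c -> exists N, forall k, (N <= k)%N -> forall a, padic_abs p (c a k) <= 1.
Proof.
move=> pp [cc c1]; apply: (@eventually_finite _ (fun a k => padic_abs p (c a k) <= 1)) => a.
case: (@Qp_abs_spec R p (c a) pp (cc a)) => [[_ /(_ 1 ltr01)[N HN]]|[q [N [_ e HN]]]].
  by exists N => k /HN /ltW.
exists N => k /HN ->; have := c1 a; rewrite e.
by rewrite -[X in _ <= X](rmorph1 (ratr : rat -> R)) ler_rat.
Qed.

Lemma hpoly_coef_close p n d (C C' : mon n d -> rat) (v : 'I_n -> nat) (e : rat) : prime p ->
  0 <= e -> (forall a, padic_abs p (C a - C' a) <= e) ->
  padic_abs p (hpoly_rat n d C (fun i => (v i)%:R)) <= e ->
  padic_abs p (hpoly_rat n d C' (fun i => (v i)%:R)) <= e.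
Proof.
move=> pp e0 CC h.
rewrite -(subrK (hpoly_rat n d C (fun i => (v i)%:R)) (hpoly_rat n d C' _)).
apply: padic_absD_le => //; rewrite -padic_absN opprB hpoly_ratB_coef.
exact: hpoly_rat_abs_le.
Qed.

(* Compactness of the unit sphere: otherwise Koenig's lemma, applied to the
   residues of near-zeros, yields a primitive zero in [Z_p^n]. *)
Lemma elliptic_primitive_bound (R : realType) p n d (c : mon n d -> Qp) : prime p ->
  coeffs_in_Zp R p c -> elliptic R p c ->
  exists N, forall k v, (N <= k)%N -> primitive p n v ->
    1 / (p ^ N)%:R < padic_abs p (hpoly_rat n d (fun a => c a k) (fun i => (v i)%:R)).
Proof.
move=> pp cZ [_ _ ell]; have cc := cZ.1.
pose f k v := padic_abs p (hpoly_rat n d (fun a => c a k) (fun i => (v i)%:R)).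
have pg k : (0 < p ^ k)%N by rewrite expn_gt0 prime_gt0.
have pgR k : (0 < (p ^ k)%:R :> rat) by rewrite ltr0n.
have pmono a b : (a <= b)%N -> 1 / (p ^ b)%:R <= 1 / (p ^ a)%:R :> rat.
  by move=> ab; rewrite !div1r lef_pV2 ?posrE // ler_nat leq_exp2l // prime_gt1.
apply: contrapT => nH.
have H N : exists k v, [/\ (N <= k)%N, primitive p n v & f k v <= 1 / (p ^ N)%:R].
  apply: contrapT => h; apply: nH; exists N => k v Nk pv; rewrite ltNge; apply/negP => h'.
  by apply: h; exists k, v.
(* The nodes of the tree: residues modulo [p ^ m] below which near-zeros of every precision lie. [N]
   also bounds [k] from below, because the near-zeros belong to varying approximations of [f]. *)
pose good m (w : 'I_n -> nat) := forall N, exists k v,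
  [/\ (N <= k)%N, primitive p n v, (forall i, v i = w i %[mod p ^ m]) & f k v <= 1 / (p ^ N)%:R].
have step m w : exists w', good m w ->
    (forall i, w' i = w i %[mod p ^ m]) /\ good m.+1 w'.
  have [gw|] := pselect (good m w); last by exists w.
  suff [w' Hw'] : exists w', (forall i, w' i = w i %[mod p ^ m]) /\ good m.+1 w' by exists w'.
  have [r Hr] : exists r : {ffun 'I_n -> 'I_(p ^ m.+1)}, forall N, exists k v,
      [/\ (N <= k)%N, primitive p n v, (forall i, v i = w i %[mod p ^ m]) &
        f k v <= 1 / (p ^ N)%:R /\ (forall i, v i %% p ^ m.+1 = r i)%N].
    (* Pigeonhole: if each of the finitely many refinements [r] failed from some [Nr r] on, a
       near-zero of precision the maximum of these would have no residue left. *)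
    apply: contrapT => /forallNP nr.
    have /choice[Nr HNr] r := (existsNP _).2 (nr r).
    have [k [v [hk pv vw fk]]] := gw (\max_r Nr r)%N.
    pose r := [ffun i => Ordinal (ltn_pmod (v i) (pg m.+1))] : {ffun 'I_n -> 'I_(p ^ m.+1)}.
    apply: (HNr r); exists k, v; split=> //; first exact: leq_trans (leq_bigmax r) hk.
    split; last by move=> i; rewrite ffunE.
    by apply: le_trans fk _; apply: pmono; exact: leq_bigmax.
  exists (fun i => r i); split.
    move=> i; have [k [v [_ _ vw [_ vr]]]] := Hr 0%N.
    by rewrite -vr modn_dvdm ?vw // dvdn_exp2l.
  move=> N; have [k [v [hk pv vw [fk vr]]]] := Hr N; exists k, v; split=> // i.
  by rewrite -vr modn_mod.
have /choice[g Hg] : forall x : nat * ('I_n -> nat), exists w', good x.1 x.2 ->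
    (forall i, w' i = x.2 i %[mod p ^ x.1]) /\ good x.1.+1 w' by case=> m w; apply: step.
pose W := fix W m := if m is m'.+1 then g (m', W m') else (fun _ => 0%N).
have gW m : good m (W m).
  elim: m => [|m IH]; last by have [] := Hg (m, W m) IH.
  move=> N; have [k [v [hk pv fk]]] := H N; exists k, v; split=> // i.
  by rewrite expn0 !modn1.
have WS m k i : (m <= k)%N -> W k i = W m i %[mod p ^ m].
  elim: k => [|k IH]; first by rewrite leqn0 => /eqP ->.
  rewrite leq_eqVlt => /orP[/eqP -> //|]; rewrite ltnS => mk.
  have [h _] := Hg (k, W k) (gW k); rewrite -(IH mk).
  have dm : (p ^ m %| p ^ k)%N by rewrite dvdn_exp2l.
  by rewrite -(modn_dvdm _ dm) h modn_dvdm.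
pose xi i : Qp := fun k => (W k i)%:R.
have cxi i : is_Qp p (xi i).
  move=> e e0; have [N HN] := inv_expn_lt p e pp e0; exists N => m k Nm Nk.
  by apply: le_lt_trans HN; rewrite padic_abs_eqmod // !WS.
have f0 : Qp_abs R p (hpoly_eval c xi) = 0.
  apply: limn_ratr_null => [k|e e0]; first exact: padic_abs_ge0.
  have [E HE] := inv_expn_lt p e pp e0.
  have [N0 HN0] := @coeffs_eventually_le1 R p n d c pp cZ.
  have [N1 HN1] := @is_Qp_unif p _ c (1 / (p ^ E)%:R) cc (divr_gt0 ltr01 (pgR E)).
  exists (maxn E N1) => m; rewrite geq_max => /andP[Em N1m].
  apply: le_lt_trans HE.
  (* Three errors of at most [p^(-E)]: the near-zero [v], its replacement by [W m], and the passage
     from the coefficients at [k] to those at [m]. *)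
  have [k [v [hk pv vW fk]]] := gW m (maxn E (maxn N0 N1)).
  move: hk; rewrite !geq_max => /and3P[Ek N0k N1k].
  apply: (@hpoly_coef_close p n d (fun a => c a k) (fun a => c a m) (W m)) => //.
  - by move=> a; apply/ltW/HN1.
  - rewrite -(subrK (hpoly_rat n d (fun a => c a k) (fun i => (v i)%:R)) (hpoly_rat n d _ _)).
    apply: padic_absD_le => //.
      apply: le_trans (pmono _ _ Em); apply: hpoly_rat_eqmod => // a.
      exact: HN0.
    by apply: le_trans fk _; apply: pmono; rewrite leq_max leqnn.
(* The branch keeps the residue modulo [p] of a primitive vector, so one coordinate of the limit has
   absolute value 1, against ellipticity. *)
have [_ [_ [k [v [_ [i ni] vW _]]]]] : True /\ good 1%N (W 1%N) /\ exists k v,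
   [/\ (0 <= k)%N, primitive p n v, (forall i, v i = W 1%N i %[mod p ^ 1]) & f k v <= 1 / (p ^ 0)%:R].
  by split=> //; split; [exact: gW | exact: (gW 1%N 0%N)].
have := (ell xi cxi).1 f0 i => /eqP.
rewrite (_ : Qp_abs R p (xi i) = 1) ?oner_eq0 //.
apply: limn_eventually_cst; exists 1%N => m m1.
have nd : ~~ (p %| W m i)%N.
  by move: ni; rewrite /dvdn; have := vW i; rewrite -(WS 1%N m i m1) expn1 => ->.
have -> : padic_abs p (xi i m) = 1; last by rewrite rmorph1.
apply: le_anti; rewrite padic_abs_nat_le1 //=.
have W0 : (0 < W m i)%N by case: (W m i) nd => //; rewrite dvdn0.
have := @padic_abs_int p (W m i)%:Z pp; rewrite /xi -pmulrn /= => -> //.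
  by rewrite lognE pp W0 (negbTE nd) expn0 divr1.
by rewrite eqz_nat -lt0n.
Qed.

(* By homogeneity, closeness of the coefficients to within the lower bound on
   primitive vectors makes a rational approximation of [f] exact for [|f|_p]. *)
Lemma elliptic_rational_model (R : realType) p n d (c : mon n d -> Qp) : prime p ->
  coeffs_in_Zp R p c -> elliptic R p c ->
  exists (C : mon n d -> rat) (N : nat),
  [/\ forall a, padic_abs p (C a) <= 1,
      forall v, primitive p n v ->
        1 / (p ^ N)%:R < padic_abs p (hpoly_rat n d C (fun i => (v i)%:R)) &
      forall M (v : 'I_n -> nat),
        Qp_abs R p (hpoly_eval c (fun i => Qp_cst ((v i)%:R / (p ^ M)%:R))) =
        ratr (padic_abs p (hpoly_rat n d C (fun i => (v i)%:R)) * (p ^ (M * d))%:R)].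
Proof.
move=> pp cZ ell; have [d0 _ _] := ell; have cc := cZ.1.
have [N HN] := @elliptic_primitive_bound R p n d c pp cZ ell.
have pgR k : (0 < (p ^ k)%:R :> rat) by rewrite ltr0n expn_gt0 prime_gt0.
have [N0 HN0] := @coeffs_eventually_le1 R p n d c pp cZ.
have [N1 HN1] := @is_Qp_unif p _ c (1 / (p ^ N)%:R) cc (divr_gt0 ltr01 (pgR N)).
pose k0 := maxn N (maxn N0 N1).
have k0N : (N <= k0)%N by rewrite leq_max leqnn.
have k0N0 : (N0 <= k0)%N by rewrite !leq_max leqnn orbT.
have k0N1 : (N1 <= k0)%N by rewrite !leq_max leqnn !orbT.
exists (fun a => c a k0), N; split; first exact: HN0; first by move=> v; apply: HN.
move=> M v; apply: limn_eventually_cst; exists k0 => k hk; congr ratr.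
have -> : hpoly_eval c (fun i => Qp_cst ((v i)%:R / (p ^ M)%:R)) k =
    hpoly_rat n d (fun a => c a k) (fun i => (p ^ M)%:R^-1 * (v i)%:R).
  by apply: eq_bigr => a _; congr (_ * _); apply: eq_bigr => i _; rewrite /Qp_cst mulrC.
rewrite hpoly_ratZ padic_absM // padic_absX // mulrC; congr (_ * _); last first.
  by rewrite -[_^-1]mul1r padic_abs_divpX // padic_abs1 // mul1r expnM !natrX.
have [v0|nv] := pselect (forall i, v i = 0%N).
  have z C : hpoly_rat n d C (fun i => (v i)%:R) = 0.
    have -> : (fun i => (v i)%:R) = (fun i => 0 * (v i)%:R) :> ('I_n -> rat).
      by apply: funext => i; rewrite v0 mul0r.
    by rewrite hpoly_ratZ expr0n gtn_eqF // mul0r.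
  by rewrite !z.
have [i vi] : exists i, v i <> 0%N by apply/existsNP.
(* The exponent [v i] is large enough, as [p ^ v i] exceeds [v i] and cannot divide it. *)
have [|s [u [_ vu pu]]] := @pdvd_factor p n v (v i).
  move=> /(_ i) /dvdn_leq; rewrite lt0n => /(_ (introN eqP vi)).
  by rewrite leqNgt ltn_expl // prime_gt1.
rewrite !(hpoly_rat_scale _ _ _ _ _ _ _ pp vu); congr (_ / _).
apply: padic_abs_eq => //; rewrite hpoly_ratB_coef.
apply: le_lt_trans (HN k0 u k0N pu); apply: hpoly_rat_abs_le => // a.
by apply/ltW/HN1 => //; exact: leq_trans k0N1 hk.
Qed.

(** * The trivial bound *)

Lemma geometric_le2 (R : realType) p W : (1 < p)%N ->
  \sum_(s < W) 1 / (p ^ s)%:R <= 2 :> R.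
Proof.
(* The exact partial sum for [p = 2], the worst case. *)
move=> p1; apply: (@le_trans _ _ (2 - 2 / (2 ^ W)%:R)); last first.
  by rewrite gerBl divr_ge0.
elim: W => [|W IH]; first by rewrite big_ord0 expn0 divr1 subrr.
rewrite big_ord_recr /=.
have h : 1 / (p ^ W)%:R <= 1 / (2 ^ W)%:R :> R.
  rewrite !div1r lef_pV2 ?posrE ?ltr0n ?expn_gt0 ?(ltnW p1) // ler_nat.
  by case: (W) => [|k]; rewrite ?expn0 // leq_exp2r.
apply: le_trans (lerD IH h) _; rewrite expnS natrM.
have : (2 ^ W)%:R != 0 :> R by rewrite pnatr_eq0 -lt0n expn_gt0.
move: ((2 ^ W)%:R : R) => z z0; rewrite le_eqVlt; apply/orP; left; apply/eqP; field.
by rewrite z0.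
Qed.

(** The ball of index [s] contains at most [p ^ ((K - W + s) * n)] points. A decay with exponent
    [n.+1] instead of [n] leaves the geometric series in [1 / p ^ s]. Summing over whole balls
    rather than shells only overcounts. *)
Lemma layered_sum_le (R : realType) p n K W (a : {ffun 'I_n -> 'I_(p ^ K)} -> R) (A0 : R) :
  prime p -> (W <= K)%N -> 0 <= A0 ->
  (forall j : {ffun 'I_n -> 'I_(p ^ K)}, exists s, [/\ (s <= W)%N, (forall i, p ^ (W - s) %| j i)%N &
      a j <= A0 / (p ^ (s * n.+1))%:R]) ->
  \sum_j a j <= 2 * A0 * (p ^ (K * n))%:R / (p ^ (W * n))%:R.
Proof.
move=> pp WK A00 H.
have pg k : (0 < (p ^ k)%:R :> R) by rewrite ltr0n expn_gt0 prime_gt0.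
pose B (s : 'I_W.+1) := [pred j : {ffun 'I_n -> 'I_(p ^ K)} | [forall i, (p ^ (W - s) %| j i)%N]].
apply: (@le_trans _ _ (\sum_j \sum_(s < W.+1) (if B s j then A0 / (p ^ (s * n.+1))%:R else 0))).
  apply: ler_sum => j _; have [s [sW Bs aj]] := H j.
  rewrite (bigD1 (Ordinal (sW : (s < W.+1)%N))) //=.
  have -> : [forall i, (p ^ (W - s) %| j i)%N] by apply/forallP.
  rewrite -[leLHS]addr0; apply: lerD => //; apply: sumr_ge0 => i _.
  by case: ifP => // _; rewrite divr_ge0 // ltW.
rewrite exchange_big /=.
apply: (@le_trans _ _ (\sum_(s < W.+1) (A0 * (p ^ (K * n))%:R / (p ^ (W * n))%:R) * (1 / (p ^ s)%:R))).
  apply: ler_sum => s _; rewrite -big_mkcond sumr_const -[_ *+ _]mulr_natl.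
  have sW : (s <= W)%N by rewrite -ltnS.
  have hc : (#|B s|)%:R <= (p ^ ((K - (W - s)) * n))%:R :> R.
    by rewrite ler_nat; apply: card_dvd_expn_le => //; lia.
  have q0 : 0 <= A0 / (p ^ (s * n.+1))%:R :> R by rewrite divr_ge0 // ltW.
  apply: le_trans (ler_wpM2r q0 hc) _.
  have e : (p ^ ((K - (W - s)) * n) * p ^ (W * n) = p ^ (K * n) * p ^ (s * n))%N.
    by rewrite -!expnD; congr (p ^ _)%N; rewrite -!mulnDl; congr (_ * _)%N; lia.
  have eR : (p ^ ((K - (W - s)) * n))%:R = (p ^ (K * n))%:R * (p ^ (s * n))%:R / (p ^ (W * n))%:R :> R.
    by rewrite -natrM -e natrM mulfK // gt_eqF.
  rewrite eR mulnS expnD natrM le_eqVlt; apply/orP; left; apply/eqP.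
  have := pg s; have := pg (W * n)%N; have := pg (s * n)%N.
  move: ((p ^ s)%:R : R) ((p ^ (W * n))%:R : R) ((p ^ (s * n))%:R : R) => z1 z2 z3 h3 h2 h1.
  by field; rewrite !gt_eqF.
rewrite -mulr_sumr mulrC -!mulrA ler_wpM2r //.
  by rewrite !mulr_ge0 // ?invr_ge0 ltW.
by apply: geometric_le2; exact: prime_gt1.
Qed.

Lemma expRN_le_factV (R : realType) (y : R) k : 0 < y -> expR (- y) <= (k.+1)`!%:R / y ^+ k.+1.
Proof.
move=> y0; have := @expR_ge1Dxn R y k (ltW y0) => h.
have f0 : (0 < (k.+1)`!%:R :> R) by rewrite ltr0n fact_gt0.
rewrite expRN -[X in _ <= X]invrK invf_div lef_pV2 ?posrE ?expR_gt0 //.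
  by apply: le_trans h; rewrite lerDr.
by rewrite divr_gt0 // exprn_gt0.
Qed.

(** Rounds the radius [1/u] to a power of [p]: the vectors [j] divisible by [p ^ W] are the points
    [j / p^M] of norm at most [p^(M-W)], which lies between [1/u] and [p/u]. *)
Lemma expn_sandwich (R : realType) p (u : R) : prime p -> 0 < u ->
  exists M0, forall M, (M0 <= M)%N ->
    exists W, (p ^ W)%:R <= (p ^ M)%:R * u < (p ^ W.+1)%:R.
Proof.
move=> pp u0; pose M0 := (Num.truncn u^-1).+1; exists M0 => M hM.
have p1 := prime_gt1 pp.
have h1 : 1 <= (p ^ M)%:R * u.
  rewrite -ler_pdivrMr // div1r; apply: ltW; apply: lt_le_trans (truncnS_gt _) _.
  by rewrite ler_nat -/M0 (leq_trans hM) // ltnW // ltn_expl.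
have h0 : 0 <= (p ^ M)%:R * u by apply: le_trans h1.
pose T := Num.truncn ((p ^ M)%:R * u); exists (trunc_log p T).
have T0 : (0 < T)%N by rewrite truncn_gt0.
have /andP[l1 l2] := trunc_log_bounds p1 T0.
have /andP[t1 t2] := truncn_itv h0.
apply/andP; split; first by apply: le_trans t1; rewrite ler_nat.
by apply: lt_le_trans t2 _; rewrite ler_nat.
Qed.

Lemma gauss_sum_le (R : realType) p n d (beta : R) (C : mon n d -> rat) N : prime p ->
  (0 < d)%N -> 0 < beta ->
  (forall v, primitive p n v ->
     1 / (p ^ N)%:R < padic_abs p (hpoly_rat n d C (fun i => (v i)%:R))) ->
  exists A : R, 0 < A /\ forall u : R, 0 < u -> exists M0, forall M, (M0 <= M)%N ->
    exists K0, forall K, (K0 <= K)%N ->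
    (p ^ (M * n))%:R / (p ^ (K * n))%:R * \sum_(j : {ffun 'I_n -> 'I_(p ^ K)})
      expR (- (u `^ (d%:R * beta)) *
        (ratr (padic_abs p (hpoly_rat n d C (fun i => (j i : nat)%:R)) * (p ^ (M * d))%:R)) `^ beta)
    <= A / u ^+ n.
Proof.
move=> pp d0 b0 H.
have pg k : (0 < (p ^ k)%:R :> R) by rewrite ltr0n expn_gt0 prime_gt0.
have pq k : (0 < (p ^ k)%:R :> rat) by rewrite ltr0n expn_gt0 prime_gt0.
have db0 : 0 < d%:R * beta by rewrite mulr_gt0 // ltr0n.
(* Chosen so that the power [k.+1] of the exponent, which grows like [p^(s d beta)] in layer [s],
   beats [p^(s (n+1))]. *)
pose k := Num.truncn (n.+1%:R / (d%:R * beta)).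
have hk : n.+1%:R <= d%:R * beta * k.+1%:R.
  by rewrite mulrC -ler_pdivrMr // ltW // truncnS_gt.
pose c : R := ((p ^ N)%:R `^ beta)^-1.
have c0 : 0 < c by rewrite invr_gt0 powR_gt0.
(* The summand 1 serves the central ball, the other one the layers outside it. *)
pose A0 : R := 1 + (k.+1)`!%:R / c ^+ k.+1.
have A1 : 1 <= A0 by rewrite lerDl divr_ge0 // exprn_ge0 // ltW.
have A00 : 0 < A0 by apply: lt_le_trans A1.
exists (2 * A0 * (p ^ n)%:R); split; first by rewrite !mulr_gt0.
move=> u u0; have [M0 HM] := @expn_sandwich R p u pp u0; exists M0 => M /HM[W /andP[W1 W2]].
exists W => K WK.
have S := @layered_sum_le R p n K W (fun j => expR (- (u `^ (d%:R * beta)) *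
        (ratr (padic_abs p (hpoly_rat n d C (fun i => (j i : nat)%:R)) * (p ^ (M * d))%:R)) `^ beta))
   A0 pp WK (ltW A00).
apply: (@le_trans _ _ ((p ^ (M * n))%:R / (p ^ (K * n))%:R * (2 * A0 * (p ^ (K * n))%:R / (p ^ (W * n))%:R))).
  apply: ler_wpM2l; first by rewrite divr_ge0 // ltW.
  apply: S => j.
  have [all_|nall] := pselect (forall i, (p ^ W %| j i)%N).
    exists 0%N; split=> //; first by move=> i; rewrite subn0.
    rewrite mul0n expn0 divr1; apply: le_trans A1.
    by rewrite -expR0 ler_expR mulNr oppr_le0 mulr_ge0 ?powR_ge0.
  have [v [vW dv lo]] := @hpoly_rat_lower p n d C N W (fun i => j i) pp H nall.
  exists (W - v)%N; split; first exact: leq_subr.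
    by move=> i; rewrite subKn // ltnW.
  set y := (_ `^ beta); rewrite mulNr.
  set s := (W - v)%N.
  (* [j / p^M] is bounded below through [p^(M-v)], and [u * p^(M-v) >= p^s] by the choice of [W];
     the loss [p^(-N)] in the lower bound for [|f|_p] becomes [c]. *)
  have ys : c * (p ^ s)%:R `^ (d%:R * beta) <= u `^ (d%:R * beta) * y.
    have r1 : ((p ^ M)%:R / (p ^ v)%:R) ^+ d / (p ^ N)%:R <=
        ratr (padic_abs p (hpoly_rat n d C (fun i => (j i : nat)%:R)) * (p ^ (M * d))%:R) :> R.
      have -> : ((p ^ M)%:R / (p ^ v)%:R) ^+ d / (p ^ N)%:R =
        ratr (1 / (p ^ (N + v * d))%:R * (p ^ (M * d))%:R) :> R.
        rewrite rmorphM /= fmorph_div /= rmorph1 !ratr_nat expnD !expnM !natrM !(natrX _ (p ^ _)%N).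
        rewrite expr_div_n invfM; ring.
      by rewrite ler_rat ler_wpM2r // ltW.
    have r2 : (((p ^ M)%:R / (p ^ v)%:R) ^+ d / (p ^ N)%:R) `^ beta <= y.
      have r0 : 0 <= ((p ^ M)%:R / (p ^ v)%:R) ^+ d / (p ^ N)%:R :> R.
        by rewrite divr_ge0 // exprn_ge0 // divr_ge0.
      by apply: ge0_ler_powR; rewrite ?nnegrE ?(ltW b0) // (le_trans r0 r1).
    apply: le_trans (ler_wpM2l (powR_ge0 _ _) r2).
    have q0 : 0 <= (p ^ M)%:R / (p ^ v)%:R :> R by rewrite divr_ge0.
    have -> : u `^ (d%:R * beta) * (((p ^ M)%:R / (p ^ v)%:R) ^+ d / (p ^ N)%:R) `^ beta =
       c * (u * ((p ^ M)%:R / (p ^ v)%:R)) `^ (d%:R * beta).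
      have e1 (q : R) : 0 <= q -> (q ^+ d) `^ beta = q `^ (d%:R * beta).
        by move=> q1; rewrite powRrM powR_mulrn.
      have e2 (q : R) : 0 <= q -> q^-1 `^ beta = (q `^ beta)^-1.
        by move=> q1; rewrite -powR_inv1 // -powRrM mulN1r powRN.
      rewrite (powRM beta) ?exprn_ge0 ?invr_ge0 // (powRM (d%:R * beta)) ?(ltW u0) //.
      by rewrite (e1 _ q0) e2 // -/c mulrA mulrC.
    rewrite ler_wpM2l ?(ltW c0) //; apply: ge0_ler_powR; rewrite ?nnegrE ?(ltW db0) //.
      by rewrite mulr_ge0 ?divr_ge0 ?ltW.
    rewrite mulrA ler_pdivlMr // -natrM -expnD subnK 1?ltnW // mulrC.
    exact: W1.
  have cs0 : 0 < c * (p ^ s)%:R `^ (d%:R * beta) by rewrite mulr_gt0 // powR_gt0.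
  apply: le_trans (_ : expR (- (c * (p ^ s)%:R `^ (d%:R * beta))) <= _).
    by rewrite ler_expR lerN2.
  apply: le_trans (@expRN_le_factV R _ k cs0) _.
  rewrite exprMn invfM mulrA; apply: ler_pM.
  - by rewrite divr_ge0 // exprn_ge0 // ltW.
  - by rewrite invr_ge0 exprn_ge0 // powR_ge0.
  - by rewrite lerDr.
  rewrite lef_pV2 ?posrE ?exprn_gt0 ?powR_gt0 //.
  rewrite -powR_mulrn ?powR_ge0 // -powRrM expnM natrX -powR_mulrn ?(ltW (pg _)) //.
  by apply: ler_powR => //; rewrite ler1n expn_gt0 prime_gt0.
have -> : (p ^ (M * n))%:R / (p ^ (K * n))%:R * (2 * A0 * (p ^ (K * n))%:R / (p ^ (W * n))%:R)
   = 2 * A0 * ((p ^ M)%:R / (p ^ W)%:R) ^+ n :> R.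
  rewrite expr_div_n -!natrX -!expnM.
  have := pg (K * n)%N; have := pg (W * n)%N.
  move: ((p ^ (K * n))%:R : R) ((p ^ (W * n))%:R : R) => z1 z2 h2 h1.
  by field; rewrite !gt_eqF.
rewrite -!mulrA !ler_pM2l // (natrX _ p n) -expr_div_n.
apply: lerXn2r; rewrite ?nnegrE ?divr_ge0 ?ler0n ?(ltW u0) //.
rewrite ler_pdivrMr // mulrAC ler_pdivlMr // -natrM -expnS.
exact: ltW.
Qed.

(** * The integral *)

(** The sample points have denominators dividing [p ^ M], so knowing [x] up to [p^(-M)] determines
    [x . xi] modulo [Z_p], for all of them at once. [N0] lets the caller ask for an index past
    another threshold. *)
Lemma Psi_rational_model (R : realType) p n (x : 'I_n -> Qp) M N0 : prime p ->
  (forall i, is_Qp p (x i)) ->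
  exists k, (N0 <= k)%N /\ forall v : 'I_n -> nat,
    let y := Qp_dot x (fun i => Qp_cst ((v i)%:R / (p ^ M)%:R)) in
    let s := \sum_i x i k / (p ^ M)%:R * (v i)%:R in
    Psi_re R p y = chi_re R p s /\ Psi_im R p y = chi_im R p s.
Proof.
move=> pp cx; have pM : (0 < (p ^ M)%:R :> rat) by rewrite ltr0n expn_gt0 prime_gt0.
have [N HN] := @is_Qp_unif p _ x (1 / (p ^ M)%:R) cx (divr_gt0 ltr01 pM).
exists (maxn N0 N); split=> [|v]; first exact: leq_maxl.
set k0 := maxn N0 N.
have H k : (N <= k)%N -> padic_abs p (\sum_i x i k * ((v i)%:R / (p ^ M)%:R)
     - \sum_i x i k0 / (p ^ M)%:R * (v i)%:R) <= 1.
  move=> Nk; rewrite -sumrB; apply: padic_abs_sum_le => // i _.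
  have -> : x i k * ((v i)%:R / (p ^ M)%:R) - x i k0 / (p ^ M)%:R * (v i)%:R =
     (x i k - x i k0) / (p ^ M)%:R * (v i)%:R by ring.
  rewrite padic_absM // padic_abs_divpX // -[leRHS]mulr1; apply: ler_pM; rewrite ?padic_abs_ge0 //.
  - by rewrite mulr_ge0 ?padic_abs_ge0.
  - by rewrite -ler_pdivlMr // ltW // HN // leq_maxr.
  - exact: padic_abs_nat_le1.
have chi k Nk := @chi_congr R p _ _ pp (H k Nk).
by split; apply: limn_eventually_cst; exists N => k /chi[].
Qed.

(** Used with [y] the larger of [X] and [u]; this is the source of the factor [2 ^ g] in the final
    constant. *)
Lemma powR_half_sum_le (R : realType) (X u y g : R) : 0 <= X -> 0 < u -> 0 <= g ->
  X + u <= 2 * y -> y `^ (- g) <= 2 `^ g * (X + u) `^ (- g).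
Proof.
move=> X0 u0 g0 h; have s0 : 0 < X + u by rewrite ltr_wpDl.
have y0 : 0 < y by have := lt_le_trans s0 h; rewrite pmulr_rgt0.
rewrite !powRN ler_pdivlMr ?powR_gt0 // mulrC ler_pdivrMr ?powR_gt0 //.
rewrite -powRM ?(ltW y0) //; apply: ge0_ler_powR; rewrite ?nnegrE ?(ltW s0) //.
by rewrite mulr_ge0 // ltW.
Qed.

Lemma Qp_norm_ge0 (R : realType) p n (x : 'I_n -> Qp) : 0 <= Qp_norm R p x.
Proof. by rewrite /Qp_norm; elim/big_rec: _ => // i y _ y0; rewrite le_max y0 orbT. Qed.

Lemma Qp_norm_attained (R : realType) p n (x : 'I_n -> Qp) : 0 < Qp_norm R p x ->
  exists i, Qp_abs R p (x i) = Qp_norm R p x.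
Proof.
rewrite /Qp_norm; elim/big_rec: _ => [|i y _ IH]; first by rewrite ltxx.
by case: (leP (Qp_abs R p (x i)) y) => _; [exact: IH | exists i].
Qed.

Lemma sqrt_sqrD_le (R : realType) (a b B : R) : `|a| <= B -> `|b| <= B ->
  Num.sqrt (a ^+ 2 + b ^+ 2) <= 2 * B.
Proof.
move=> ha hb; have B0 : 0 <= B by apply: le_trans ha.
have sq z : `|z| <= B -> z ^+ 2 <= B ^+ 2.
  by move=> hz; rewrite -real_normK ?num_real // lerXn2r ?nnegrE.
rewrite -[leRHS]ger0_norm ?mulr_ge0 // -sqrtr_sqr ler_wsqrtr //.
have := sq a ha; have := sq b hb; have : 0 <= B ^+ 2 by rewrite sqr_ge0.
by rewrite exprMn; lra.
Qed.

(** The character is bounded by 1 in absolute value. The estimate holds for every [x], but has the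
    required order only when [||x||_p] is at most a constant times [u]. *)
Lemma Z_small_x (R : realType) p n d (beta : R) (c : mon n d -> Qp) : prime p -> 0 < beta ->
  coeffs_in_Zp R p c -> elliptic R p c ->
  exists A : R, 0 < A /\ forall x t, (forall i, is_Qp p (x i)) -> 0 < t ->
    Z_abs p beta c x t <= A / (t `^ (1 / (beta * d%:R))) ^+ n.
Proof.
move=> pp b0 cZ ell; have [d0 _ _] := ell.
have [C [N [C1 prim mdl]]] := @elliptic_rational_model R p n d c pp cZ ell.
have [A [A0 HA]] := @gauss_sum_le R p n d beta C N pp d0 b0 prim.
exists (2 * A); split=> [|x t cx t0]; first by rewrite mulr_gt0.
set u := t `^ _; have u0 : 0 < u by rewrite powR_gt0.
have ut : u `^ (d%:R * beta) = t.
  rewrite /u -powRrM div1r mulrC [beta * _]mulrC mulfV ?powRr1 ?(ltW t0) //.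
  by rewrite gt_eqF // mulr_gt0 // ltr0n.
have [M0 HM] := HA u u0.
rewrite -mulrA; apply: sqrt_sqrD_le; apply: haar_int_norm_le;
  rewrite ?divr_ge0 ?exprn_ge0 ?(ltW A0) ?(ltW u0) //;
  exists M0 => M /HM[K0 HK]; exists K0 => K /HK; rewrite ut; apply: le_trans;
  have [k [_ psi]] := @Psi_rational_model R p n x M 0 pp cx;
  rewrite normrM ger0_norm ?divr_ge0 //; apply: ler_wpM2l; rewrite ?divr_ge0 //;
  apply: le_trans (ler_norm_sum _ _ _) _; apply: ler_sum => j _;
  rewrite (mdl M (fun i => j i : nat)) normrM [X in _ * X]ger0_norm ?expR_ge0 //;
  rewrite -[leRHS]mul1r ler_wpM2r ?expR_ge0 //.
- by rewrite (psi (fun i => j i : nat)).1 chi_re_norm.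
- by rewrite (psi (fun i => j i : nat)).2 chi_im_norm.
Qed.

Lemma Z_large_x (R : realType) p n d (beta : R) (c : mon n d -> Qp) : prime p -> 0 < beta ->
  coeffs_in_Zp R p c -> elliptic R p c ->
  exists A : R, 0 < A /\ forall x t, (forall i, is_Qp p (x i)) -> 0 < t -> 0 < Qp_norm R p x ->
    Z_abs p beta c x t <= A * t * Qp_norm R p x `^ (- (d%:R * beta + n%:R)).
Proof.
move=> pp b0 cZ ell; have [d0 _ _] := ell.
have [C [N [C1 prim mdl]]] := @elliptic_rational_model R p n d c pp cZ ell.
have pg k : (0 < (p ^ k)%:R :> R) by rewrite ltr0n expn_gt0 prime_gt0.
have pq k : (0 < (p ^ k)%:R :> rat) by rewrite ltr0n expn_gt0 prime_gt0.
set g := d%:R * beta + n%:R.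
exists (2 * (p ^ N.+1)%:R `^ g); split=> [|x t cx t0 x0]; first by rewrite mulr_gt0 ?powR_gt0.
set X := Qp_norm R p x in x0 *.
have [i0 hi0] : exists i, Qp_abs R p (x i) = X by exact: Qp_norm_attained.
case: (@Qp_abs_spec R p (x i0) pp (cx i0)) => [[e _]|[q [Nq [q0 eq_ HNq]]]].
  by move: x0; rewrite -hi0 e ltxx.
have [a [b qab]] := @padic_abs_expE p q pp q0.
have XE : X = (p ^ a)%:R / (p ^ b)%:R.
  by rewrite -hi0 eq_ qab fmorph_div /= !ratr_nat.
(* [Y] is [x / p^M], so that the character is evaluated at integer vectors. Its largest coordinate
   has absolute value [||x|| p^M = p^E], and the bound on [M] makes [E >= N+1]. *)
have key M : (b + N.+1 <= M)%N -> let E := (a + M - b)%N in exists Y : 'I_n -> rat,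
   [/\ (N.+1 <= E)%N, padic_abs p (Y i0) = (p ^ E)%:R &
    forall v : 'I_n -> nat,
      Psi_re R p (Qp_dot x (fun i => Qp_cst ((v i)%:R / (p ^ M)%:R))) = chi_re R p (\sum_i Y i * (v i)%:R) /\
      Psi_im R p (Qp_dot x (fun i => Qp_cst ((v i)%:R / (p ^ M)%:R))) = chi_im R p (\sum_i Y i * (v i)%:R)].
  move=> hM E; have [k [Nk psi]] := @Psi_rational_model R p n x M Nq pp cx.
  exists (fun i => x i k / (p ^ M)%:R); split; rewrite /E; first by lia.
    rewrite padic_abs_divpX // HNq // qab mulrAC -natrM -expnD.
    by rewrite -{1}(subnK (_ : (b <= a + M)%N)) ?expnD ?natrM ?mulfK ?gt_eqF //; lia.
  by move=> v; exact: psi.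
(* Bounds [t |f|^beta] on the flattened ball, hence the change of weight there, by
   [1 - exp(-z) <= z]. *)
pose delta M : R := t * (ratr (1 / (p ^ ((a + M - b - N.+1) * d))%:R * (p ^ (M * d))%:R)) `^ beta.
(* With [r = p^(N+1)/||x||], the left side is the volume [r^n] of the ball times [t r^(d beta)]: [M]
   and [K] cancel. *)
have bound M K : (b + N.+1 <= M)%N -> (a + M - b <= K)%N ->
  (p ^ (M * n))%:R / (p ^ (K * n))%:R * ((p ^ ((K - (a + M - b - N.+1)) * n))%:R * delta M) =
   (p ^ N.+1)%:R `^ g * t * X `^ (- g).
  move=> hM hK; set w := (a + M - b - N.+1)%N.
  have Q0 : 0 < (p ^ N.+1)%:R / X by rewrite divr_gt0.
  have QE : (p ^ M)%:R / (p ^ w)%:R = (p ^ N.+1)%:R / X.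
    have e : (p ^ M * p ^ a = p ^ N.+1 * p ^ b * p ^ w)%N.
      by rewrite -!expnD; congr (p ^ _)%N; rewrite /w; lia.
    have nz k : (p ^ k)%:R != 0 :> R by rewrite gt_eqF.
    by apply/eqP; rewrite XE invf_div mulrA eqr_div // -!natrM e.
  have -> : delta M = t * ((p ^ N.+1)%:R / X) `^ (d%:R * beta).
    rewrite /delta -/w powRrM powR_mulrn ?(ltW Q0) // -QE expr_div_n; congr (_ * _ `^ _).
    by rewrite rmorphM /= fmorph_div /= rmorph1 !ratr_nat !expnM !natrX; ring.
  have -> : (p ^ (M * n))%:R / (p ^ (K * n))%:R * ((p ^ ((K - w) * n))%:R * (t * ((p ^ N.+1)%:R / X) `^ (d%:R * beta)))
    = t * (((p ^ N.+1)%:R / X) `^ (d%:R * beta) * ((p ^ N.+1)%:R / X) ^+ n).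
    have e : (p ^ (K * n) = p ^ ((K - w) * n) * p ^ (w * n))%N.
      by rewrite -expnD -mulnDl subnK // /w; lia.
    rewrite -[in X in _ = _ * (_ * X)]QE expr_div_n -!natrX -!expnM e natrM.
    have := pg ((K - w) * n)%N; have := pg (w * n)%N.
    move: ((p ^ ((K - w) * n))%:R : R) ((p ^ (w * n))%:R : R) (_ `^ _) => z1 z2 z3 h2 h1.
    by field; rewrite !gt_eqF.
  rewrite -powR_mulrn ?(ltW Q0) // -powRD ?(gt_eqF Q0) ?implybT // -/g.
  rewrite powRM ?invr_ge0 ?(ltW x0) // -(powR_inv1 (ltW x0)) -powRrM mulN1r.
  by ring.
pose F M (s : rat) : R := expR (- t * (ratr (s * (p ^ (M * d))%:R)) `^ beta).
have HF M s : s <= 1 / (p ^ ((a + M - b - N.+1) * d))%:R -> 0 <= s -> `|F M s - 1| <= delta M.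
  move=> hs s0; rewrite /F; set y := _ `^ beta.
  have y0 : 0 <= y by apply: powR_ge0.
  have h1 : expR (- t * y) <= 1 by rewrite -expR0 ler_expR mulNr oppr_le0 mulr_ge0 // ltW.
  rewrite distrC ger0_norm ?subr_ge0 //.
  apply: (@le_trans _ _ (t * y)).
    by have := expR_ge1Dx (- t * y); rewrite mulNr; lra.
  rewrite ler_wpM2l ?(ltW t0) //; apply: ge0_ler_powR; rewrite ?nnegrE ?(ltW b0) ?ler0q //.
  - by rewrite mulr_ge0 // ltW.
  - by rewrite ler_rat ler_wpM2r // ltW.
have B0 : 0 <= (p ^ N.+1)%:R `^ g * t * X `^ (- g).
  by rewrite !mulr_ge0 ?powR_ge0 // ltW.
(* Abstracting the character treats the real and imaginary parts by one argument. *)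
have main (Ps : Qp -> R) (ch : rat -> R) :
    (forall M K, (b + N.+1 <= M)%N -> (a + M - b <= K)%N -> exists Y : 'I_n -> rat,
      (forall v : 'I_n -> nat,
        Ps (Qp_dot x (fun i => Qp_cst ((v i)%:R / (p ^ M)%:R))) = ch (\sum_i Y i * (v i)%:R)) /\
      `|\sum_(j : {ffun 'I_n -> 'I_(p ^ K)}) ch (\sum_i Y i * (j i : nat)%:R) *
          F M (padic_abs p (hpoly_rat n d C (fun i => (j i : nat)%:R)))|
        <= (p ^ ((K - (a + M - b - N.+1)) * n))%:R * delta M) ->
    `|haar_int p (fun xi => Ps (Qp_dot x xi) *
        expR (- t * (Qp_abs R p (hpoly_eval c xi)) `^ beta))|
      <= (p ^ N.+1)%:R `^ g * t * X `^ (- g).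
  move=> hch; apply: haar_int_norm_le; first exact: B0.
  exists (b + N.+1)%N => M hM; exists (a + M - b)%N => K hK.
  have [Y [psi S]] := hch M K hM hK.
  have r0 : 0 <= (p ^ (M * n))%:R / (p ^ (K * n))%:R :> R by rewrite divr_ge0.
  rewrite -(bound M K hM hK).
  rewrite normrM (ger0_norm r0); apply: (ler_wpM2l r0); apply: le_trans S.
  rewrite le_eqVlt; apply/orP; left; apply/eqP; congr `|_|; apply: eq_bigr => j _.
  by rewrite (mdl M (fun i => j i : nat)) (psi (fun i => j i : nat)).
have -> : 2 * (p ^ N.+1)%:R `^ g * t * X `^ (- g) = 2 * ((p ^ N.+1)%:R `^ g * t * X `^ (- g)).
  by rewrite !mulrA.
apply: sqrt_sqrD_le; apply: main => M K hM hK; have [Y [NE aY psi]] := key M hM;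
  have [S1 S2] := @chi_sum_le R p n d K (a + M - b) N Y i0 C (F M) (delta M)
    pp NE hK aY C1 prim (HF M); exists Y.
- by split=> [v|]; [exact: (psi v).1 | exact: S1].
- by split=> [v|]; [exact: (psi v).2 | exact: S2].
Qed.

Theorem theorem1 (R : realType) (p n d : nat) (beta : R) (c : mon n d -> Qp) :
  prime p -> (1 <= n)%N -> 0 < beta ->
  coeffs_in_Zp R p c -> elliptic R p c ->
  exists A : R, 0 < A /\
    forall (x : 'I_n -> Qp), (forall i, is_Qp p (x i)) ->
    forall t : R, 0 < t ->
      Z_abs p beta c x t <=
        A * t * powR (Qp_norm R p x + powR t (1 / (beta * d%:R)))
                     (- (d%:R * beta + n%:R)).
Proof.
move=> pp n1 b0 cZ ell; have [d0 _ _] := ell.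
have [A1 [A10 H1]] := @Z_small_x R p n d beta c pp b0 cZ ell.
have [A2 [A20 H2]] := @Z_large_x R p n d beta c pp b0 cZ ell.
have g0 : 0 <= d%:R * beta + n%:R :> R by rewrite addr_ge0 // mulr_ge0 // ltW.
set g := d%:R * beta + n%:R in H2 g0 *.
exists ((A1 + A2) * 2 `^ g); split; first by rewrite mulr_gt0 ?powR_gt0 ?addr_gt0.
move=> x cx t t0; set u := t `^ _; set X := Qp_norm R p x.
have u0 : 0 < u by apply: powR_gt0.
have X0 : 0 <= X by exact: Qp_norm_ge0.
suff [y [B [yX hB hZ]]] : exists y B, [/\ X + u <= 2 * y, 0 <= B <= A1 + A2 &
    Z_abs p beta c x t <= B * t * y `^ (- g)].
  have /andP[B0 B1] := hB; apply: le_trans hZ _.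
  have h := @powR_half_sum_le R X u y g X0 u0 g0 yX.
  rewrite -!mulrA [2 `^ g * _]mulrCA !mulrA -!mulrA.
  by apply: ler_pM => //; rewrite ?mulr_ge0 ?powR_ge0 ?(ltW t0) // ler_wpM2l // ltW.
have [Xu|uX] := leP X u.
  exists u, A1; split.
  - by lra.
  - by rewrite ltW //= lerDl ltW.
  apply: le_trans (H1 x t cx t0) _; rewrite -/u -mulrA ler_wpM2l ?(ltW A10) //.
  (* This turns [u^(-n)] into [t u^(-d beta - n)], the form common to both regimes. *)
  have -> : t = u `^ (d%:R * beta).
    rewrite /u -powRrM div1r mulrC [beta * _]mulrC mulfV ?powRr1 ?(ltW t0) //.
    by rewrite gt_eqF // mulr_gt0 // ltr0n.
  rewrite -powRD ?(gt_eqF u0) ?implybT // /g opprD addrA subrr add0r.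
  by rewrite powRN powR_mulrn // ltW.
exists X, A2; split.
- by lra.
- by rewrite ltW //= lerDr ltW.
by apply: H2 => //; exact: lt_trans uX.
Qed.
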